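(* Let $(\mathscr{A},\tau)$ be a $W^\star$-non commutative probability space, let $P\in\mathscr{A}$ be an orthogonal projection with $\tau(P)=\theta\in(0,1)$, let $Y=(Y_t)_{t\ge0}\subset\mathscr{A}$ be a free unitary Brownian motion $\star$-free from $P$, and let $U\in\mathscr{A}$ be a Haar unitary $\star$-free from $P$. Then for every $t>0$ the spectral distributions of $PY_tPY_t^\star P$ and of $PUPU^\star P$ in the compressed non commutative probability space $(P\mathscr{A}P,(1/\theta)\tau)$ assign the same weight at $x=1$, namely $$\frac1\theta\max(2\theta-1,0).$$
   Context: A $W^\star$-non commutative probability space $(\mathscr{A},\tau)$ is a von Neumann algebra $\mathscr{A}$ with unit ${\bf 1}$ endowed with a faithful (normal) tracial state $\tau$. A free unitary Brownian motion $Y=(Y_t)_{t\ge0}$ is a family of unitaries in $\mathscr{A}$ with $Y_0={\bf 1}$, with stationary $\star$-free multiplicative increments (i.e. for $0\le t_1<\dots<t_n$ the elements $Y_{t_1},Y_{t_2}Y_{t_1}^\star,\dots,Y_{t_n}Y_{t_{n-1}}^\star$ are $\star$-free and $Y_tY_s^\star$ has the law of $Y_{t-s}$ for $s<t$), and with moments $\tau(Y_t^k)=\tau((Y_t^\star)^k)=e^{-kt/2}\frac1k L^{(1)}_{k-1}(kt)$, $k\ge1$, where $L^{(1)}_{n}$ is the $n$-th Laguerre polynomial of parameter $1$ (in particular $\tau(Y_t)=e^{-t/2}$). A Haar unitary is a unitary $U$ with $\tau(U^k)=0$ for all $k\in\mathbb{Z}\setminus\{0\}$. The spectral distribution of a self-adjoint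 element $J$ of $P\mathscr{A}P$ is the probability measure $\nu$ on $\mathbb{R}$ with $\frac1\theta\tau(J^n)=\int x^n\,\nu(dx)$ for all $n\ge1$. *)

(* Defs.v *)
From HB Require Import structures.
From mathcomp Require Import all_boot all_order all_algebra.
From mathcomp Require Import sesquilinear complex.
From mathcomp Require Import all_classical all_reals all_analysis.

Set Implicit Arguments.
Unset Strict Implicit.
Unset Printing Implicit Defensive.

Import Order.TTheory GRing.Theory Num.Theory.
Import numFieldNormedType.Exports.

(* The complex field is R[i] for an arbitrary R : realType. *)

Local Open Scope classical_set_scope.
Local Open Scope ring_scope.
Local Open Scope complex_scope.

Section BoundedOperators.
Context {K : numFieldType} {H : normedModType K}.

Definition bounded_operator : set (H -> H) :=
  [set T | linear T /\ continuous T].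

(* The commutant taken inside B(H). *)
Definition commutant (S : set (H -> H)) : set (H -> H) :=
  [set T | bounded_operator T /\
           forall T', S T' -> forall x, T (T' x) = T' (T x)].

End BoundedOperators.

(* A von Neumann algebra is a *-subalgebra of B(H) equal to its bicommutant.
   Its elements are kept in an abstract algebra vn_alg, identified with the
   operator algebra through the injective map vn_op.  The Hilbert space is the
   complete normed space vn_space, whose norm comes from the inner product
   vn_inner (linear in its first argument).  The laws of the involution follow
   from vn_op_star and injectivity. *)
Record vonNeumannAlgebra (R : realType) := VonNeumannAlgebra {
  vn_alg :> algType R[i];
  vn_space : completeNormedModType R[i];
  vn_inner : {dot vn_space for (@Num.conj R[i])};
  vn_op : vn_alg -> vn_space -> vn_space;
  star : vn_alg -> vn_alg;
  vn_innerE : forall x : vn_space, vn_inner x x = `|x| ^+ 2;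
  vn_op_bounded : forall a, bounded_operator (vn_op a);
  vn_op_linear : forall (c : R[i]) (a b : vn_alg) (x : vn_space),
    vn_op (c *: a + b) x = c *: vn_op a x + vn_op b x;
  vn_op1 : forall x, vn_op 1 x = x;
  vn_opM : forall (a b : vn_alg) (x : vn_space),
    vn_op (a * b) x = vn_op a (vn_op b x);
  vn_op_star : forall a x y,
    vn_inner (vn_op (star a) x) y = vn_inner x (vn_op a y);
  vn_op_inj : injective vn_op;
  vn_bicommutant : commutant (commutant (range vn_op)) = range vn_op
}.

Arguments star {R v} a.

Section OperatorOrder.
Context {R : realType} {A : vonNeumannAlgebra R}.

Definition op_le (a b : A) : Prop :=
  forall x : vn_space A, 0 <= vn_inner A (vn_op (b - a) x) x.

Definition op_directed (D : set A) : Prop :=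
  D !=set0 /\
  forall a b, D a -> D b -> exists c, [/\ D c, op_le a c & op_le b c].

Definition op_lub (D : set A) (s : A) : Prop :=
  (forall a, D a -> op_le a s) /\
  (forall b, (forall a, D a -> op_le a b) -> op_le s b).

(* For a positive functional, normality says that suprema of bounded
   increasing nets of self-adjoint elements are preserved. *)
Definition normal_functional (phi : A -> R[i]) : Prop :=
  forall (D : set A) (s : A),
    (forall a, D a -> star a = a) -> op_directed D -> op_lub D s ->
    (forall a, D a -> phi a <= phi s) /\
    (forall c : R[i], (forall a, D a -> phi a <= c) -> phi s <= c).

End OperatorOrder.

Record wstarProbSpace (R : realType) := WstarProbSpace {
  wstar_vn :> vonNeumannAlgebra R;
  tau : {scalar wstar_vn};
  tau1 : tau 1 = 1;
  tau_ge0 : forall a : wstar_vn, 0 <= tau (star a * a);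
  tau_faithful : forall a : wstar_vn, tau (star a * a) = 0 -> a = 0;
  tau_tracial : forall a b : wstar_vn, tau (a * b) = tau (b * a);
  tau_normal : normal_functional tau
}.

Section Elements.
Context {R : realType} {A : wstarProbSpace R}.
Implicit Types (x y P U J : A) (G : set A).

Definition orthogonal_projection P : Prop := P * P = P /\ star P = P.

Definition unitary U : Prop := star U * U = 1 /\ U * star U = 1.

Definition unital_star_subalgebra (B : set A) : Prop :=
  [/\ B 1,
      forall (c : R[i]) x y, B x -> B y -> B (c *: x + y),
      forall x y, B x -> B y -> B (x * y) &
      forall x, B x -> B (star x)].

Definition star_algebra (G : set A) : set A :=
  smallest unital_star_subalgebra G.

(* Freeness of the unital *-algebras generated by the sets G i: a product of
   centred elements, consecutive ones coming from different algebras, is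
   centred.  A word is a list of pairs (index, element). *)
Definition star_free (I : eqType) (G : I -> set A) : Prop :=
  forall w : seq (I * A),
    w != [::] ->
    sorted (fun p q => p.1 != q.1) w ->
    (forall p, p \in w -> star_algebra (G p.1) p.2 /\ tau A p.2 = 0) ->
    tau A (\prod_(p <- w) p.2) = 0.

Definition star_free2 (G1 G2 : set A) : Prop :=
  star_free (fun b : bool => if b then G1 else G2).

Definition same_law x y : Prop :=
  forall w : seq bool,
    tau A (\prod_(b <- w) (if b then star x else x)) =
    tau A (\prod_(b <- w) (if b then star y else y)).

Definition haar_unitary U : Prop :=
  unitary U /\
  forall k : nat, (0 < k)%N -> tau A (U ^+ k) = 0 /\ tau A (star U ^+ k) = 0.

End Elements.

(* L_n^(alpha)(x) = sum_(j <= n) (-1)^j binomial(n + alpha, n - j) x^j / j! *)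
Definition laguerre (R : realType) (alpha n : nat) : {poly R} :=
  \poly_(j < n.+1) ((-1) ^+ j * 'C(n + alpha, n - j)%:R / j`!%:R).

Section FreeUnitaryBrownianMotion.
Context {R : realType} {A : wstarProbSpace R}.

Definition increment (Y : R -> A) (s : nat -> R) (i : nat) : A :=
  if i is j.+1 then Y (s i) * star (Y (s j)) else Y (s 0%N).

(* Only the values Y t with 0 <= t are meaningful. *)
Definition free_unitary_brownian_motion (Y : R -> A) : Prop :=
  [/\ forall t, 0 <= t -> unitary (Y t),
      Y 0 = 1,
      forall (n : nat) (s : nat -> R),
        0 <= s 0%N -> (forall i, (i.+1 < n)%N -> s i < s i.+1) ->
        star_free (fun i : 'I_n => [set increment Y s i]),
      forall s t, 0 <= s -> s < t -> same_law (Y t * star (Y s)) (Y (t - s)) &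
      forall (t : R) (k : nat), 0 <= t -> (0 < k)%N ->
        let m : R := expR (- (k%:R * t) / 2) * k%:R^-1 *
                     (laguerre R 1 k.-1).[k%:R * t] in
        tau A (Y t ^+ k) = m%:C /\ tau A (star (Y t) ^+ k) = m%:C].

(* nu is the distribution of J in the compression of (A, tau) by P, whose
   state is tau / tau(P); the 0-th moment is fixed by nu being a probability. *)
Definition spectral_distribution (P J : A)
    (nu : probability (measurableTypeR R) R) : Prop :=
  [/\ P * J * P = J,
      star J = J &
      forall n : nat, (0 < n)%N ->
        nu.-integrable [set: R] (fun x : R => (x ^+ n)%:E) /\
        (tau A P)^-1 * tau A (J ^+ n) =
          (\int[nu]_(x in [set: R]) (x ^+ n))%R%:C].

End FreeUnitaryBrownianMotion.

(* Main.v *)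
Require Import Defs.
From HB Require Import structures.
From mathcomp Require Import all_boot all_order all_algebra.
From mathcomp Require Import sesquilinear complex.
From mathcomp Require Import all_classical all_reals all_analysis.
From mathcomp Require Import measurable_realfun ring lra.
Set Implicit Arguments.
Unset Strict Implicit.
Unset Printing Implicit Defensive.
Import Order.TTheory GRing.Theory Num.Theory.
Import numFieldNormedType.Exports.
Local Open Scope classical_set_scope.
Local Open Scope ring_scope.
Local Open Scope complex_scope.

(** Write V for Y_t or for U (so that V^-1 is its adjoint), Q = V P V^-1,
    T = P Q P and S = (1 - P) (1 - Q) (1 - P).  The element of the statement is
    T, a positive contraction, so the mass of its spectral distribution at 1 is
    the limit of tau(T^n) / theta ([atom_of_moments]), and it has to be shown
    that tau(T^n) tends to max(2 theta - 1, 0) ([moment_cvg]).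

    The element y = P Q (1 - P) satisfies y y' = T - T^2, y' y = S - S^2 (y' its
    adjoint) and T y = y S.  Hence tau(T^n) - tau(S^n) does not depend on n, and
    equals tau(P) + tau(Q) - 1 = 2 theta - 1 ([moment_compl]).  Both sequences
    decrease to nonnegative limits, so it remains to prove that one of the two
    limits is 0.  In terms of the limits e of T^n and f of S^n, which are the
    projections on the intersections of the ranges and of the kernels of P and Q,
    this says that e = 0 or f = 0: the projections P and Q are in general position.

    Freeness of V and P enters through one device.  Let R(y) be the component
    of y on the alternating products of centred elements which end with a factor
    from the algebra N of V ([word_end]).  For the scalar product
    (x, y) |-> tau(x y') the map R is an orthogonal projection, by freeness
    ([word_end_nrm]); it commutes with left multiplication by P
    ([word_end_mull_other]); and for n in N,
      R(n y) = n R(y) + tau(y) n - tau(n y)     ([word_end_mull]).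
    Since (1 - P) e = 0 and (1 - P) V^-1 e = 0, applying R yields
      (1 - P) R(e) = 0,
      (1 - P) (V^-1 R(e) + tau(e) V^-1 - tau(V^-1 e)) = 0.
    Multiply the second equation on the left by f V.  As f = f (1 - P) and
    f V (1 - P) V^-1 = f, and then f R(e) = 0, what is left is
      tau(e) f = tau(V^-1 e) f V,
    and so tau(e) tau(f) = tau(V^-1 e) tau(f V).  But |tau(f V)| <= tau(f) and
    |tau(V^-1 e)| <= tau(e).  If e and f are both nonzero the last inequality is
    an equality, and equality in Cauchy-Schwarz forces w V^-1 e = e for some
    scalar w of modulus 1.  Then e is also fixed by averages of powers of
    w V^-1; when tau(V^k) tends to 0 such averages can have arbitrarily small
    norm, a contradiction.

    The projections e and f are never formed.  The argument is run on T^n and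
    S^n with error terms controlled by the vanishing differences
    tau(T^2n) - tau(T^(2n+1)) ([kernel_estimate], [almost_fixed],
    [mixing_fixed], [moments_not_both_bounded_below]).

    That tau(V^k) tends to 0 holds by definition for a Haar unitary.  For Y_t,
    tau(Y_t^k) = u(kt) / (k^2 t) with u(x) = x exp(-x/2) L(x), where L is the
    Laguerre polynomial of degree k - 1 and parameter 1.  This u solves
    u'' = - (k/x - 1/4) u, so the energy u'^2 + (k/x - 1/4) u^2 decreases from
    its value k^2 at 0.  It bounds u on (0, ks) for s < 4, and u' up to the
    turning point 4k, beyond which |u| decreases.  Together these bounds give
    u(kt) = o(k^2) for every t > 0 ([u_bound], [laguerre_moment_small]). *)

(** * The involution *)
Section Star.
Context {R : realType} {A : vonNeumannAlgebra R}.
Implicit Types a b : A.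

Lemma vn_inner_inj (x y : vn_space A) :
  (forall z, vn_inner A x z = vn_inner A y z) -> x = y.
Proof.
move=> h; apply/eqP; rewrite -subr_eq0 -normr_eq0 -sqrf_eq0 -vn_innerE.
by rewrite linearBl /= h subrr.
Qed.

Lemma vn_innerC (x y : vn_space A) : vn_inner A x y = (vn_inner A y x)^*%R.
Proof. by rewrite hermC /= expr0 mul1r. Qed.

(** Adjoints are unique, so every algebraic law of the involution follows by
    checking it against the inner product. *)
Lemma star_unique a b :
  (forall x y, vn_inner A (vn_op b x) y = vn_inner A x (vn_op a y)) -> b = star a.
Proof.
move=> h; apply: vn_op_inj; apply/funext => x; apply: vn_inner_inj => y.
by rewrite h vn_op_star.
Qed.

Lemma starK a : star (star a) = a.
Proof.
apply/esym/star_unique => x y.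
by rewrite vn_innerC -vn_op_star -vn_innerC.
Qed.

Lemma starM a b : star (a * b) = star b * star a.
Proof. by apply/esym/star_unique => x y; rewrite !vn_opM !vn_op_star. Qed.

Lemma star1 : star (1 : A) = 1.
Proof. by apply/esym/star_unique => x y; rewrite !vn_op1. Qed.

Lemma star_linear (c : R[i]) a b : star (c *: a + b) = c^* *: star a + star b.
Proof.
apply/esym/star_unique => x y; rewrite !vn_op_linear linearDl linearDr /=.
by rewrite linearZl_LR /= linearZr_LR /= !vn_op_star.
Qed.

Lemma star0 : star (0 : A) = 0.
Proof. by have := star_linear (-1) (0 : A) 0; rewrite scaler0 addr0 rmorphN1 scaleN1r addNr. Qed.

Lemma starZ (c : R[i]) a : star (c *: a) = c^* *: star a.
Proof. by have := star_linear c a 0; rewrite !star0 !addr0. Qed.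
Lemma starD a b : star (a + b) = star a + star b.
Proof. by have := star_linear 1 a b; rewrite rmorph1 !scale1r. Qed.
Lemma starN a : star (- a) = - star a.
Proof. by rewrite -scaleN1r starZ rmorphN1 scaleN1r. Qed.
Lemma starB a b : star (a - b) = star a - star b.
Proof. by rewrite starD starN. Qed.
Lemma starX a n : star (a ^+ n) = star a ^+ n.
Proof. by elim: n => [|n IH]; rewrite ?expr0 ?star1 // exprS exprSr starM IH. Qed.
End Star.

(** * Moduli of complex numbers *)
Notation normc := Normc.normc.
Section Modulus.
Context {R : realType}.
Implicit Types z w : R[i].

Lemma normcE z : `|z| = (normc z)%:C. Proof. by []. Qed.
Lemma normcD z w : normc (z + w) <= normc z + normc w.
Proof. exact: le_normcD. Qed.
Lemma normcNE z : normc (- z) = normc z. Proof. exact: normcN. Qed.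
Lemma normcB z w : normc (z - w) <= normc z + normc w.
Proof. by rewrite -(normcNE w) normcD. Qed.
Lemma normc_ge0 z : 0 <= normc z.
Proof. by rewrite -ler0c -normcE. Qed.
Lemma normc_real (x : R) : normc x%:C = `|x|.
Proof. by rewrite /normc /= expr0n /= addr0 sqrtr_sqr. Qed.
Lemma ReD z w : complex.Re (z + w) = complex.Re z + complex.Re w.
Proof. by case: z; case: w. Qed.
Lemma ReB z w : complex.Re (z - w) = complex.Re z - complex.Re w.
Proof. by case: z; case: w. Qed.
Lemma Re_le_normc z : complex.Re z <= normc z.
Proof.
case: z => a b /=; apply: le_trans (ler_norm _) _.
by rewrite -sqrtr_sqr ler_wsqrtr // lerDl sqr_ge0.
Qed.
Lemma normc_conj z : normc z^* = normc z.
Proof. by case: z => a b /=; rewrite sqrrN. Qed.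
Lemma mulc_conj z : z * z^* = (normc z ^+ 2)%:C.
Proof.
case: z => a b /=; rewrite sqr_sqrtr ?addr_ge0 ?sqr_ge0 //.
by apply/eqP; rewrite eq_complex /=; apply/andP; split; apply/eqP; ring.
Qed.
Lemma normc_phase z : exists2 w, normc w = 1 & w * z = (normc z)%:C.
Proof.
have [->|z0] := eqVneq z 0.
  by exists 1; rewrite ?Normc.normc1 // mul1r Normc.normc0.
have n0 : normc z != 0 by apply: contra z0 => /eqP/Normc.eq0_normc ->.
exists ((normc z)^-1%:C * z^*).
  rewrite Normc.normcM normc_conj normc_real ger0_norm ?invr_ge0 ?normc_ge0 //.
  by rewrite mulVf.
by rewrite -mulrA (mulrC _ z) mulc_conj -rmorphM /= expr2 mulrA mulVf // mul1r.
Qed.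
End Modulus.

(** * The trace norm *)
Section Trace.
Context {R : realType} {A : wstarProbSpace R}.
Implicit Types x y : A.
Local Notation tr := (tau A).

Lemma tauZ (c : R[i]) x : tr (c *: x) = c * tr x.
Proof. by rewrite linearZ. Qed.

Lemma tauD x y : tr (x + y) = tr x + tr y.
Proof. by rewrite raddfD. Qed.
Lemma tauB x y : tr (x - y) = tr x - tr y.
Proof. by rewrite raddfB. Qed.
Lemma tauN x : tr (- x) = - tr x.
Proof. by rewrite raddfN. Qed.
Lemma tau0 : tr 0 = 0.
Proof. by rewrite raddf0. Qed.

(** A positive functional is real on a a', hence on the cross terms of
    (a + 1) (a + 1)'; applied to x and to i x this fixes both the real and the
    imaginary part. *)
Lemma tau_star x : tr (star x) = (tr x)^*.
Proof.
have h (a : A) : complex.Im (tr a + tr (star a)) = 0.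
  have := tau_ge0 (a + 1); rewrite starD star1 mulrDl !mulrDr mul1r !mulr1.
  rewrite !raddfD /= tau1 => /ger0_Im; have /ger0_Im := tau_ge0 a.
  by rewrite !raddfD /= => ->; rewrite add0r addr0 addrC.
have h1 := h x; have := h ('i *: x).
rewrite starZ linearZ linearZ /=.
case: (tr x) h1 => a b; case: (tr (star x)) => c d /= h1 h2.
apply/eqP; rewrite eq_complex /=; apply/andP; split; apply/eqP; move: h1 h2; lra.
Qed.

Definition sqn x : R := complex.Re (tr (x * star x)).

Lemma sqnE x : tr (x * star x) = (sqn x)%:C.
Proof.
by rewrite /sqn RRe_real // ger0_real // tau_tracial tau_ge0.
Qed.
Lemma sqn_ge0 x : 0 <= sqn x.
Proof. by rewrite -ler0c -sqnE tau_tracial tau_ge0. Qed.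
Lemma sqn_star x : sqn (star x) = sqn x.
Proof. by rewrite /sqn starK tau_tracial. Qed.

Lemma sqnB x y : sqn (x - y) = sqn x + sqn y - 2 * complex.Re (tr (x * star y)).
Proof.
rewrite /sqn starB mulrBl !mulrBr !raddfB /=.
have -> : tr (y * star x) = (tr (x * star y))^*.
  by rewrite -tau_star starM starK.
by case: (tr (x * star y)) => a b /=; ring.
Qed.
Lemma sqnZ (c : R[i]) x : sqn (c *: x) = normc c ^+ 2 * sqn x.
Proof.
apply: complexI; rewrite -sqnE starZ -scalerAl -scalerAr scalerA linearZ /=.
by rewrite mulc_conj sqnE [RHS]rmorphM.
Qed.
Lemma sqnN x : sqn (- x) = sqn x.
Proof. by rewrite -scaleN1r sqnZ normcNE Normc.normc1 expr1n mul1r. Qed.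
Lemma sqnD x y : sqn (x + y) = sqn x + sqn y + 2 * complex.Re (tr (x * star y)).
Proof.
rewrite -{1}[y]opprK sqnB sqnN starN mulrN tauN.
by case: (tr (x * star y)) => a b /=; rewrite mulrN opprK.
Qed.
Lemma sqn_eq0 x : sqn x = 0 -> x = 0.
Proof.
move=> h; rewrite -[x]starK (@tau_faithful _ _ (star x)) ?star0 //.
by rewrite starK sqnE h.
Qed.

Lemma cauchy_schwarz_sqr x y : normc (tr (x * y)) ^+ 2 <= sqn x * sqn y.
Proof.
rewrite -(sqn_star y) -{1}(starK y); move: (star y) => {}y.
have [y0|y0] := eqVneq (sqn y) 0.
  by rewrite (sqn_eq0 y0) star0 mulr0 raddf0 Normc.normc0 expr0n mulr_ge0 ?sqn_ge0.
set z := tr _; have yp : 0 < sqn y by rewrite lt_def y0 sqn_ge0.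
have := sqn_ge0 (x - (z / (sqn y)%:C) *: y).
rewrite sqnB starZ -scalerAr tauZ sqnZ -/z.
have -> : (z / (sqn y)%:C)^* * z = (normc z ^+ 2 / sqn y)%:C.
  by rewrite -fmorphV rmorphM [X in _ * X * _]conjc_real mulrAC [_^* * z]mulrC mulc_conj -rmorphM.
rewrite Normc.normcM Normc.normcV normc_real ger0_norm ?sqn_ge0 // exprMn.
set m := normc z ^+ 2; set s := sqn y.
have -> : sqn x + m * s^-1 ^+ 2 * s - 2 * (m * s^-1) = sqn x - m / s by field.
by rewrite subr_ge0 ler_pdivrMr.
Qed.

Definition nrm x : R := Num.sqrt (sqn x).
Lemma nrm_ge0 x : 0 <= nrm x. Proof. exact: sqrtr_ge0. Qed.
Lemma nrm_sqr x : nrm x ^+ 2 = sqn x. Proof. by rewrite sqr_sqrtr ?sqn_ge0. Qed.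
Lemma nrm_star x : nrm (star x) = nrm x. Proof. by rewrite /nrm sqn_star. Qed.

Lemma cauchy_schwarz x y : normc (tr (x * y)) <= nrm x * nrm y.
Proof.
rewrite -(@ler_pXn2r _ 2) ?nnegrE ?normc_ge0 ?mulr_ge0 ?nrm_ge0 //.
by rewrite exprMn !nrm_sqr cauchy_schwarz_sqr.
Qed.
Lemma nrm1 : nrm 1 = 1.
Proof. by rewrite /nrm /sqn star1 mulr1 tau1 sqrtr1. Qed.
Lemma normc_tau_le x : normc (tr x) <= nrm x.
Proof. by rewrite -{1}[x]mulr1 (le_trans (cauchy_schwarz _ _)) // nrm1 mulr1. Qed.
Lemma nrmZ (c : R[i]) x : nrm (c *: x) = normc c * nrm x.
Proof.
by rewrite /nrm sqnZ sqrtrM ?sqr_ge0 // sqrtr_sqr ger0_norm ?normc_ge0.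
Qed.
Lemma nrmD x y : nrm (x + y) <= nrm x + nrm y.
Proof.
rewrite -(@ler_pXn2r _ 2) ?nnegrE ?addr_ge0 ?nrm_ge0 //.
rewrite sqrrD !nrm_sqr sqnD.
have := le_trans (Re_le_normc _) (cauchy_schwarz x (star y)); rewrite nrm_star.
by case: (tr _) => a b /=; lra.
Qed.
Lemma nrm0 : nrm 0 = 0.
Proof. by rewrite -(scale0r (0 : A)) nrmZ Normc.normc0 mul0r. Qed.

End Trace.

(** * Generated star-algebras *)
Section StarAlgebra.
Context {R : realType} {A : wstarProbSpace R}.
Implicit Types (G : set A) (x y : A).

Lemma star_algebra_unital G : unital_star_subalgebra (star_algebra G).
Proof.
split.
- by move=> B [[h1 _ _ _] _].
- move=> c x y hx hy B hB; have [[_ h _ _] _] := hB.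
  by apply: h; [exact: hx|exact: hy].
- move=> x y hx hy B hB; have [[_ _ h _] _] := hB.
  by apply: h; [exact: hx|exact: hy].
- move=> x hx B hB; have [[_ _ _ h] _] := hB.
  by apply: h; exact: hx.
Qed.

Lemma sub_star_algebra G : G `<=` star_algebra G.
Proof. by move=> x Gx B [_]; exact. Qed.

Lemma star_algebra_mono G G' : G `<=` G' -> star_algebra G `<=` star_algebra G'.
Proof.
move=> sG x hx; apply: hx; split; first exact: star_algebra_unital.
exact: subset_trans sG (@sub_star_algebra _).
Qed.

Lemma star_algebra_centre G x :
  star_algebra G x -> star_algebra G (x - (tau A x)%:A).
Proof.
have [h1 hD _ _] := star_algebra_unital G => hx.
by rewrite addrC -scaleNr; apply: hD.
Qed.

End StarAlgebra.

(** * Projection on the words ending in a given algebra *)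
Section FreePair.
Context {R : realType} {A : wstarProbSpace R}.
Variable G : bool -> set A.
Hypothesis freeG : star_free G.
Local Notation tr := (tau A).
Local Notation alg i := (star_algebra (G i)).
Local Notation wprod w := (\prod_(p <- w) p.2).
Implicit Types (x y z n : A) (w : seq (bool * A)) (i c : bool) (k : R[i]).

Definition centred_word w :=
  sorted (fun p q => p.1 != q.1) w /\
  forall p, p \in w -> alg p.1 p.2 /\ tr p.2 = 0.

(** A span given inductively, so that statements linear in the element need
    checking on single words only.  The empty word, that is the scalars, is left
    out. *)
Inductive word_span c : A -> Prop :=
| word_span0 : word_span c 0
| word_spanPl k p w x : centred_word (p :: w) -> (last p w).1 = c -> word_span c x ->
    word_span c (k *: wprod (p :: w) + x).

Lemma word_spanP c k x y : word_span c x -> word_span c y -> word_span c (k *: x + y).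
Proof.
move=> hx hy; elim: hx => [|k' p w z hw hl _ IH]; first by rewrite scaler0 add0r.
by rewrite scalerDr scalerA -addrA; apply: word_spanPl.
Qed.
Lemma word_span_word c p w : centred_word (p :: w) -> (last p w).1 = c ->
  word_span c (wprod (p :: w)).
Proof.
move=> hw hl; rewrite -[wprod _]scale1r -[_ *: _]addr0.
exact/word_spanPl/word_span0.
Qed.

Lemma tau_word p w : centred_word (p :: w) -> tr (wprod (p :: w)) = 0.
Proof. by case=> hs hc; apply: freeG. Qed.

Lemma tau_word_span c x : word_span c x -> tr x = 0.
Proof.
elim=> [|k p w y hw _ _ IH]; first by rewrite tau0.
by rewrite tauD tauZ tau_word // IH mulr0 addr0.
Qed.

Lemma centred_word_cons p q w : centred_word (q :: w) -> p.1 != q.1 ->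
  alg p.1 p.2 -> tr p.2 = 0 -> centred_word [:: p, q & w].
Proof.
move=> [hs hc] pq hp tp; split; first by rewrite /= pq.
by move=> r; rewrite inE => /orP[/eqP->|/hc].
Qed.

Lemma centred_word_tail p w : centred_word (p :: w) -> centred_word w.
Proof.
move=> [/path_sorted hs hc]; split=> // q qw.
by apply: hc; rewrite inE qw orbT.
Qed.

Lemma centred_letter i n : alg i n -> centred_word [:: (i, n - (tr n)%:A)].
Proof.
move=> hn; split=> // p; rewrite inE => /eqP ->; split.
  exact: star_algebra_centre.
by rewrite tauB tauZ tau1 mulr1 subrr.
Qed.

(** Either n is absorbed by the first letter p, or it becomes a new first letter;
    centring the resulting letter splits the product into shorter or longer
    words with the same last letter.  The only exception is a one-letter word of
    the same index as n, where a scalar appears; that scalar is the trace. *)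
Lemma word_span_mull_word i n p w : alg i n -> centred_word (p :: w) ->
  let c := (last p w).1 in let W := wprod (p :: w) in
  word_span c (n * W - (tr (n * W))%:A) /\ (i != c -> tr (n * W) = 0).
Proof.
move=> hn hw c W; have [ip|ip] := eqVneq i p.1.
  have hm : alg i (n * p.2).
    have [_ _ hM _] := star_algebra_unital (G i); apply: hM => //.
    by rewrite ip; have [_ /(_ p)] := hw; rewrite mem_head => /(_ isT) [].
  have [_ /(_ _ (mem_head _ _)) [h1 h2]] := centred_letter hm.
  case: w hw @c @W => [|q w] hw c W.
    rewrite /W /c /= big_seq1; split; last by rewrite ip eqxx.
    have := word_span_word (centred_letter hm) erefl.
    by rewrite big_seq1 /= ip.
  set m := n * p.2 in hm h1 h2.
  have pq : p.1 != q.1 by case: hw => /= /andP[].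
  have hw' := centred_word_tail hw.
  have hmw : centred_word [:: (i, m - (tr m)%:A), q & w].
    by apply: centred_word_cons; rewrite //= ip.
  have nW : n * W = wprod [:: (i, m - (tr m)%:A), q & w] +
                    tr m *: wprod (q :: w).
    by rewrite /W big_cons mulrA [in RHS]big_cons /= mulrBl -scalerAl mul1r subrK.
  have t0 : tr (n * W) = 0.
    by rewrite nW tauD tauZ !tau_word // mulr0 addr0.
  rewrite t0 scale0r subr0; split=> //; rewrite nW addrC.
  by apply: word_spanP; apply: word_span_word.
have hnw : centred_word [:: (i, n - (tr n)%:A), p & w].
  have [_ /(_ _ (mem_head _ _)) [h1 h2]] := centred_letter hn.
  exact: centred_word_cons.
have nW : n * W = wprod [:: (i, n - (tr n)%:A), p & w] + tr n *: W.
  by rewrite [in RHS]big_cons /= mulrBl -scalerAl mul1r subrK.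
have t0 : tr (n * W) = 0.
  by rewrite nW tauD tauZ !tau_word // mulr0 addr0.
rewrite t0 scale0r subr0; split=> //; rewrite nW addrC.
by apply: word_spanP; apply: word_span_word.
Qed.

Lemma word_span_mull i c n x : alg i n -> word_span c x ->
  word_span c (n * x - (tr (n * x))%:A).
Proof.
move=> hn; elim=> [|k p w y hw <- _ IH].
  by rewrite mulr0 tau0 scale0r subrr; apply: word_span0.
have [h _] := word_span_mull_word hn hw.
have := word_spanP k h IH; congr word_span.
rewrite mulrDr -scalerAr tauD tauZ scalerBr scalerDl scalerA.
by rewrite opprD addrACA.
Qed.

Lemma tau_mull_word_span i c n x : alg i n -> word_span c x -> i != c -> tr (n * x) = 0.
Proof.
move=> hn hx ic; elim: hx => [|k p w y hw hl _ IH].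
  by rewrite mulr0 tau0.
have [_ h] := word_span_mull_word hn hw.
by rewrite mulrDr -scalerAr tauD tauZ h ?hl // IH mulr0 addr0.
Qed.

Lemma star_wprod w : star (wprod w) = wprod (rev [seq (p.1, star p.2) | p <- w]).
Proof.
elim: w => [|p w IH]; first by rewrite !big_nil star1.
by rewrite big_cons starM IH /= rev_cons -cats1 big_cat big_seq1.
Qed.

(** By traciality it is y x' that is examined: y ends in one algebra and x'
    begins in the other, so their concatenation alternates and freeness makes
    its trace vanish. *)
Lemma word_span_orth c c' x y : word_span c x -> word_span c' y -> c != c' ->
  tr (y * star x) = 0.
Proof.
move=> hx hy cc; elim: hx => [|k p w z hw hl _ IH].
  by rewrite star0 mulr0 tau0.
rewrite starD starZ mulrDr -scalerAr tauD tauZ IH addr0.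
suff -> : tr (y * star (wprod (p :: w))) = 0 by rewrite mulr0.
elim: hy => [|k' p' w' z' hw' hl' _ IH']; first by rewrite mul0r tau0.
rewrite mulrDl -scalerAl tauD tauZ IH' addr0 star_wprod -big_cat.
rewrite [tr _](_ : _ = 0) ?mulr0 //; apply: tau_word.
have rn : rev [seq (p.1, star p.2) | p <- p :: w] =
    ((last p w).1, star (last p w).2) ::
     behead (rev [seq (p.1, star p.2) | p <- p :: w]).
  by rewrite lastI map_rcons rev_rcons.
have [hs hc] := hw; have [hs' hc'] := hw'.
have srt : sorted (fun p q => p.1 != q.1)
    (rev [seq (p.1, star p.2) | p <- p :: w]).
  rewrite rev_sorted sorted_map; move: hs; congr is_true.
  by apply: eq_path => a b; rewrite /= eq_sym.
split.
  rewrite -cat_cons /= cat_path; apply/andP; split=> //.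
  move: srt; rewrite rn => srt; apply/andP; split=> //.
  by rewrite hl hl' eq_sym.
move=> q; rewrite -cat_cons mem_cat => /orP[/hc' //|].
rewrite mem_rev => /mapP[r rw ->] /=; have [h1 h2] := hc _ rw.
split; first by have [_ _ _ h] := star_algebra_unital (G r.1); apply: h.
by rewrite tau_star h2 rmorph0.
Qed.

(** The component r of y on the words ending in the algebra of index c, as a
    relation: the rules below build an r along with y, one left multiplication at
    a time, and bound its norm by that of y. *)
Definition word_end c y r :=
  exists t z, [/\ word_span c r, word_span (~~ c) z & y = r + z + t%:A].

Lemma word_end1 c : word_end c 1 0.
Proof. by exists 1, 0; split; [exact: word_span0..|rewrite !add0r scale1r]. Qed.

Lemma tau_word_end c t r z : word_span c r -> word_span (~~ c) z ->
  tr (r + z + t%:A) = t.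
Proof.
move=> hr hz; rewrite !tauD (tau_word_span hr) (tau_word_span hz) tauZ tau1.
by rewrite !add0r mulr1.
Qed.

Lemma word_end_linear c k y r y' r' :
  word_end c y r -> word_end c y' r' -> word_end c (k *: y + y') (k *: r + r').
Proof.
move=> [t [z [h1 h2 ->]]] [t' [z' [h3 h4 ->]]].
exists (k * t + t'), (k *: z + z'); split; try exact: word_spanP.
by rewrite !scalerDr scalerDl scalerA addrACA; congr (_ + _); rewrite addrACA.
Qed.

Lemma word_end_mull_other c b y r : alg (~~ c) b ->
  word_end c y r -> word_end c (b * y) (b * r).
Proof.
move=> hb [t [z [h1 h2 ->]]]; have cc : ~~ c != c by case: (c).
exists (t * tr b + tr (b * z)), (t *: (b - (tr b)%:A) + (b * z - (tr (b * z))%:A)).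
split.
- have := word_span_mull hb h1.
  by rewrite (tau_mull_word_span hb h1 cc) scale0r subr0.
- apply: word_spanP; last exact: word_span_mull hb h2.
  by have := word_span_word (centred_letter hb) erefl; rewrite big_seq1.
rewrite !mulrDr -scalerAr mulr1 -[LHS]addrA -[RHS]addrA; congr (_ + _).
by rewrite scalerBr scalerA scalerDl [RHS]addrACA !subrK addrC.
Qed.

(** Left multiplication by n keeps the last letter of a word, except that it can
    turn scalars into words of index c and words of index c into scalars; the two
    correction terms account for this. *)
Lemma word_end_mull c n y r : alg c n ->
  word_end c y r -> word_end c (n * y) (n * r + tr y *: n - (tr (n * y))%:A).
Proof.
move=> hn [t [z [h1 h2 ->]]]; have cc : c != ~~ c by case: (c).
have nz := tau_mull_word_span hn h2 cc; rewrite (tau_word_end t h1 h2).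
exists (tr (n * (r + z + t%:A))), (n * z); split.
- have := word_spanP t (word_span_word (centred_letter hn) erefl) (word_span_mull hn h1).
  rewrite big_seq1 /=; congr word_span.
  rewrite !mulrDr -scalerAr mulr1 !tauD nz tauZ addr0.
  by rewrite scalerBr scalerA addrACA -opprD -scalerDl [_ + n * r]addrC [_ + tr (n * r)]addrC.
- by have := word_span_mull hn h2; rewrite nz scale0r subr0.
rewrite [n * r + _ - _ + _]addrAC subrK !mulrDr -scalerAr mulr1.
by rewrite addrAC.
Qed.

Lemma word_end_nrm c y r : word_end c y r -> nrm r <= nrm y.
Proof.
move=> [t [z [h1 h2 ->]]]; have cc : c != ~~ c by case: (c).
have o : tr ((r + z + t%:A) * star r) = (sqn r)%:C.
  rewrite !mulrDl !tauD (word_span_orth h1 h2 cc) sqnE.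
  by rewrite -scalerAl mul1r tauZ tau_star (tau_word_span h1) rmorph0 mulr0 !addr0.
rewrite ler_wsqrtr //; have := sqn_ge0 (r + z + t%:A - r).
by rewrite sqnB o /=; lra.
Qed.

End FreePair.

(** * Moments of a pair of projections *)
Section TwoProjections.
Context {R : realType} {A : wstarProbSpace R}.
Local Notation tr := (tau A).
Implicit Types x y P Q : A.

Definition moment x n : R := complex.Re (tr (x ^+ n)).


Lemma projection_compl P : orthogonal_projection P -> orthogonal_projection (1 - P).
Proof.
move=> [PP sP]; split; last by rewrite starB star1 sP.
by rewrite mulrBl mul1r mulrBr mulr1 PP subrr subr0.
Qed.

Section OnePair.
Variables P Q : A.
Hypotheses (hP : orthogonal_projection P) (hQ : orthogonal_projection Q).
Let T := P * Q * P.

Lemma pqpK : T * P = T. Proof. by rewrite /T -mulrA hP.1. Qed.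
Lemma Kpqp : P * T = T. Proof. by rewrite /T !mulrA hP.1. Qed.
Lemma star_pqp : star T = T.
Proof. by rewrite /T !starM hP.2 hQ.2 mulrA. Qed.
Lemma pqpXK n : T ^+ n.+1 * P = T ^+ n.+1.
Proof. by rewrite exprSr -mulrA pqpK. Qed.
Lemma KpqpX n : P * T ^+ n.+1 = T ^+ n.+1.
Proof. by rewrite exprS mulrA Kpqp. Qed.
Lemma pq_qp : P * Q * (Q * P) = T.
Proof. by rewrite mulrA -(mulrA P Q Q) hQ.1. Qed.

Lemma tau_pqp_even n : tr (T ^+ n.*2) = (sqn (T ^+ n))%:C.
Proof. by rewrite -sqnE starX star_pqp -exprD addnn. Qed.

Lemma tau_pqp_odd n : tr (T ^+ n.*2.+1) = (sqn (T ^+ n * P * Q))%:C.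
Proof.
rewrite -sqnE !starM starX star_pqp hP.2 hQ.2; congr (tr _).
rewrite (_ : T ^+ n * _ * _ * _ = T ^+ n * (P * Q * (Q * P)) * T ^+ n).
  by rewrite pq_qp -exprSr -exprD addSn addnn.
by rewrite !mulrA.
Qed.

Lemma tau_pqp n : tr (T ^+ n) = (moment T n)%:C.
Proof.
rewrite /moment -[n]odd_double_half; case: (odd n); rewrite ?add1n ?add0n.
  by rewrite tau_pqp_odd.
by rewrite tau_pqp_even.
Qed.

Lemma moment_ge0 n : 0 <= moment T n.
Proof.
rewrite /moment -[n]odd_double_half; case: (odd n); rewrite ?add1n ?add0n.
  by rewrite tau_pqp_odd sqn_ge0.
by rewrite tau_pqp_even sqn_ge0.
Qed.

Lemma moment_diff_even n :
  moment T n.+1.*2 - moment T n.+1.*2.+1 = sqn (T ^+ n.+1 * (1 - Q)).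
Proof.
rewrite /moment /sqn starM starX star_pqp (projection_compl hQ).2 -ReB -tauB.
congr (complex.Re (tr _)).
rewrite (_ : _ * _ * _ = T ^+ n.+1 * ((1 - Q) * (1 - Q)) * T ^+ n.+1); last first.
  by rewrite !mulrA.
rewrite (projection_compl hQ).1 mulrBr mulr1 mulrBl -exprD addnn; congr (_ - _).
rewrite -{1}(pqpXK n) -{2}(KpqpX n).
rewrite (_ : _ * _ * _ = T ^+ n.+1 * T * T ^+ n.+1); last by rewrite /T !mulrA.
by rewrite -exprSr -exprD addSn addnn.
Qed.


(** The off-diagonal corner of Q with respect to P, which links T to its
    counterpart S for the complementary projections. *)
Let y := P * Q * (1 - P).

Lemma pqp_defect : y * star y = T - T * T.
Proof.
rewrite /y !starM hP.2 hQ.2 (projection_compl hP).2.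
rewrite (_ : _ * _ = P * Q * ((1 - P) * (1 - P)) * (Q * P)); last by rewrite !mulrA.
rewrite (projection_compl hP).1 mulrBr mulr1 mulrBl pq_qp; congr (_ - _).
rewrite (_ : _ * _ * _ = P * Q * P * Q * P); last by rewrite !mulrA.
by rewrite /T !mulrA -(mulrA (P * Q) P P) hP.1.
Qed.

Lemma tau_pqp_diff n : tr (T ^+ n.+1) - tr (T ^+ n.+2) = tr (T ^+ n * y * star y).
Proof.
by rewrite -tauB -mulrA pqp_defect mulrBr [T ^+ n * (T * T)]mulrA -!exprSr.
Qed.

Lemma moment_diff_odd n : moment T n.*2.+1 - moment T n.*2.+2 = sqn (T ^+ n * y).
Proof.
rewrite /moment -!ReB tau_pqp_diff /sqn -addnn exprD -!mulrA tau_tracial.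
by rewrite starM starX star_pqp !mulrA.
Qed.

Lemma moment1_le1 : moment T 1 <= 1.
Proof.
have h1 := sqn_ge0 (P * (1 - Q)); have h2 := sqn_ge0 (1 - P).
have : sqn (P * (1 - Q)) + sqn (1 - P) + moment T 1 = 1; last by lra.
rewrite /moment /sqn !starM (projection_compl hQ).2 (projection_compl hP).2 hP.2 expr1.
rewrite (_ : _ * _ * _ = P * ((1 - Q) * (1 - Q)) * P); last by rewrite !mulrA.
rewrite (projection_compl hQ).1 (projection_compl hP).1 -!ReD -!tauD.
rewrite mulrBr mulr1 mulrBl hP.1 -/T.
by rewrite addrAC subrK addrCA subrr addr0 tau1.
Qed.

(** Consecutive differences are squared norms, of different elements for even
    and for odd exponents. *)
Lemma moment_nincr n : (0 < n)%N -> moment T n.+1 <= moment T n.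
Proof.
rewrite -subr_ge0 -[n]odd_double_half; case: (odd n); rewrite ?add1n ?add0n.
  by rewrite moment_diff_odd sqn_ge0.
by case: (n./2) => // m _; rewrite moment_diff_even sqn_ge0.
Qed.

Lemma moment_le1 n : (0 < n)%N -> moment T n <= 1.
Proof.
case: n => // n _; elim: n => [|n IH]; first exact: moment1_le1.
by apply: le_trans IH; apply: moment_nincr.
Qed.

Lemma nrm_pqpX_le1 n : (0 < n)%N -> nrm (T ^+ n) <= 1.
Proof.
move=> n0; rewrite -sqrtr1 ler_wsqrtr //.
have := tau_pqp_even n; rewrite tau_pqp => /complexI <-.
by rewrite moment_le1 // double_gt0.
Qed.

Let S := (1 - P) * (1 - Q) * (1 - P).

(** This and the two expressions for y y' and y' y say that y carries the part of
    S away from 0 and 1 onto the corresponding part of T. *)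
Lemma pqp_intertwine : T * y = y * S.
Proof.
rewrite /y /S.
rewrite (_ : T * _ = P * Q * (P * P) * Q * (1 - P)); last by rewrite /T !mulrA.
rewrite [RHS](_ : _ = P * Q * ((1 - P) * (1 - P)) * (1 - Q) * (1 - P)); last first.
  by rewrite !mulrA.
rewrite hP.1 (projection_compl hP).1.
have Pq : P * (1 - P) = 0 by rewrite mulrBr mulr1 hP.1 subrr.
have Qq : Q * (1 - Q) = 0 by rewrite mulrBr mulr1 hQ.1 subrr.
rewrite [P * Q * (1 - P)]mulrBr mulr1 !mulrBl -(mulrA P Q (1 - Q)) Qq mulr0 mul0r sub0r.
by rewrite [P * Q * P * (1 - Q)]mulrBr mulr1 mulrBl -(mulrA _ P (1 - P)) Pq mulr0 sub0r opprK.
Qed.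

Lemma pqpX_intertwine n : T ^+ n * y = y * S ^+ n.
Proof.
elim: n => [|n IH]; first by rewrite !expr0 mul1r mulr1.
by rewrite exprSr -mulrA pqp_intertwine mulrA IH -mulrA -exprSr.
Qed.

Lemma compl_defect : star y * y = S - S * S.
Proof.
rewrite /y !starM hP.2 hQ.2 (projection_compl hP).2.
have q2 := (projection_compl hP).1.
have [q qE] : exists q, 1 - P = q by exists (1 - P).
rewrite /S qE in q2 *; pose W := q * Q * q.
have -> : q * (1 - Q) * q = q - W by rewrite mulrBr mulr1 mulrBl q2.
have W2 : q * (Q * P) * (P * Q * q) = W - W * W.
  rewrite (_ : _ * _ = q * Q * (P * P) * Q * q); last by rewrite !mulrA.
  rewrite hP.1 (_ : P = 1 - q); last by rewrite -qE subKr.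
  rewrite mulrBr mulr1 !mulrBl.
  rewrite -(mulrA q Q Q) hQ.1; congr (_ - _).
  rewrite (_ : W * W = q * Q * (q * q) * Q * q); last by rewrite /W !mulrA.
  by rewrite q2.
rewrite W2 mulrBl !mulrBr q2.
have -> : q * W = W by rewrite /W !mulrA q2.
have -> : W * q = W by rewrite /W -mulrA q2.
by rewrite subKr.
Qed.

Lemma moment_diff_compl n : moment T n.+1 - moment T n.+2 = moment S n.+1 - moment S n.+2.
Proof.
rewrite /moment -!ReB tau_pqp_diff pqpX_intertwine -mulrA tau_tracial -mulrA compl_defect.
by rewrite mulrBr [S ^+ n * (S * S)]mulrA -!exprSr tauB.
Qed.

(** The decrements of both sequences are traces of T^n y y' = y S^n y', hence
    equal; so the difference of the moments is its value for n = 1. *)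
Lemma moment_compl n : (0 < n)%N ->
  moment T n - moment S n = complex.Re (tr P) + complex.Re (tr Q) - 1.
Proof.
case: n => // n _; elim: n => [|n IH]; last by have := moment_diff_compl n; lra.
rewrite /moment !expr1.
have -> : tr T = tr (P * Q) by rewrite /T tau_tracial mulrA hP.1.
have -> : tr S = tr ((1 - P) * (1 - Q)).
  by rewrite /S tau_tracial mulrA (projection_compl hP).1.
rewrite mulrBr mulr1 mulrBl mul1r !tauB tau1.
by case: (tr P) => a b; case: (tr Q) => c d; case: (tr _) => e f /=; ring.
Qed.

End OnePair.
End TwoProjections.

(** * Almost fixed vectors of unitaries with decaying moments *)
Section Mixing.
Context {R : realType} {A : wstarProbSpace R}.
Local Notation tr := (tau A).
Implicit Types x y P Q V W : A.

Lemma unitary_star V : unitary V -> unitary (star V).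
Proof. by move=> [h1 h2]; split; rewrite starK. Qed.

Lemma nrm_unitaryl V x : unitary V -> nrm (V * x) = nrm x.
Proof.
move=> [hV _]; congr Num.sqrt; rewrite /sqn starM; congr complex.Re.
by rewrite -mulrA tau_tracial -!mulrA hV mulr1.
Qed.

Lemma nrm_unitaryr V x : unitary V -> nrm (x * V) = nrm x.
Proof.
move=> hV; rewrite -nrm_star starM nrm_unitaryl ?nrm_star //.
exact: unitary_star.
Qed.

Lemma sqn_unitary V : unitary V -> sqn V = 1.
Proof. by move=> [_ hV]; rewrite /sqn hV tau1. Qed.

Lemma unitaryX V n : unitary V -> unitary (V ^+ n).
Proof.
move=> [h1 h2]; have c : GRing.comm (star V) V by rewrite /GRing.comm h1 h2.
by split; rewrite starX -exprMn_comm ?h1 ?h2 ?expr1n.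
Qed.

Lemma unitaryZ w V : normc w = 1 -> unitary V -> unitary (w *: V).
Proof.
move=> hw [h1 h2]; have ww : w * w^* = 1 by rewrite mulc_conj hw expr1n.
split; rewrite starZ -scalerAl -scalerAr scalerA ?h1 ?h2 ?ww ?scale1r //.
by rewrite mulrC ww scale1r.
Qed.

Lemma conj_projection V P : unitary V -> orthogonal_projection P ->
  orthogonal_projection (V * P * star V).
Proof.
move=> [hV _] [PP sP]; split; last by rewrite !starM starK sP mulrA.
rewrite (_ : _ * _ = V * P * (star V * V) * P * star V); last by rewrite !mulrA.
by rewrite hV mulr1 -(mulrA V P P) PP.
Qed.

(** The exponents are multiples of J, so all inner products of two distinct
    terms are moments of order at least J and bounded by e. *)
Lemma sqn_sum_powers W (J K : nat) (e : R) : unitary W ->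
  (0 < J)%N -> (forall j, (J <= j)%N -> normc (tr (W ^+ j)) <= e) ->
  sqn (\sum_(k < K) W ^+ (J * k)) <= K%:R + K%:R ^+ 2 * e.
Proof.
move=> hW J0 he; elim: K => [|K IH].
  by rewrite big_ord0 /sqn mul0r tau0 expr0n /= mul0r addr0.
rewrite big_ord_recr /=; set X := \sum_(k < K) _ in IH *.
set x := W ^+ (J * K).
have hx : sqn x = 1 by apply/sqn_unitary/unitaryX.
have hXx : normc (tr (X * star x)) <= K%:R * e.
  rewrite /X mulr_suml raddf_sum /=.
  have h (k : 'I_K) : normc (tr (W ^+ (J * k) * star x)) <= e.
    have -> : star x = star (W ^+ (J * (K - k))) * star (W ^+ (J * k)).
      by rewrite -starM -exprD -mulnDr subnKC // ltnW.
    rewrite tau_tracial -mulrA.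
    have [-> _] := unitaryX (J * k) hW; rewrite mulr1 tau_star normc_conj he //.
    by rewrite leq_pmulr // subn_gt0.
  move: (star x) h => y h; clear -h; elim: K h => [|K IH] h.
    by rewrite big_ord0 Normc.normc0 mul0r.
  rewrite big_ord_recr /=; apply: le_trans (normcD _ _) _.
  rewrite -natr1 mulrDl mul1r lerD ?(h ord_max) //.
  by apply: IH => k; exact: (h (widen_ord (leqnSn K) k)).
rewrite sqnD.
have := le_trans (Re_le_normc _) hXx; rewrite hx -natr1.
have e0 : 0 <= e by apply: le_trans (normc_ge0 _) (he J _).
by move: IH; nra.
Qed.

Lemma nrm_powers_sub W x k : unitary W ->
  nrm (W ^+ k * x - x) <= k%:R * nrm (W * x - x).
Proof.
move=> hW; elim: k => [|k IH]; first by rewrite mul1r subrr nrm0 mul0r.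
have -> : W ^+ k.+1 * x - x = W * (W ^+ k * x - x) + (W * x - x).
  by rewrite mulrBr addrA subrK mulrA -exprS.
apply: le_trans (nrmD _ _) _; rewrite nrm_unitaryl // -natr1 mulrDl mul1r.
by rewrite lerD2r.
Qed.

(** If W x is close to x then x is close to the average of the K elements
    W^(Jk) x, while that average is small by the previous bound.  Dividing by K,
    the last term is of order 1 / sqrt K + sqrt e. *)
Lemma mixing_fixed W (J K : nat) (e : R) x : unitary W -> (0 < J)%N ->
  (forall j, (J <= j)%N -> normc (tr (W ^+ j)) <= e) ->
  nrm x <= 1 -> nrm (x * star x) <= 1 ->
  K%:R * sqn x <= (J * K * K)%:R * nrm (W * x - x) +
                  Num.sqrt (K%:R + K%:R ^+ 2 * e).
Proof.
move=> hW J0 he x1 xx1; set X := \sum_(k < K) W ^+ (J * k).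
have hX : nrm X <= Num.sqrt (K%:R + K%:R ^+ 2 * e).
  by apply: ler_wsqrtr; apply: sqn_sum_powers.
have h1 : normc (tr (X * x * star x)) <= nrm X.
  rewrite -mulrA; apply: le_trans (cauchy_schwarz _ _) _.
  by rewrite ler_piMr // nrm_ge0.
set n := nrm (W * x - x).
have h2 : normc (tr ((X * x - K%:R *: x) * star x)) <= (J * K * K)%:R * n.
  apply: le_trans (cauchy_schwarz _ _) _; rewrite nrm_star.
  apply: le_trans (_ : nrm (X * x - K%:R *: x) <= _); first by rewrite ler_piMr // nrm_ge0.
  have -> : X * x - K%:R *: x = \sum_(k < K) (W ^+ (J * k) * x - x).
    rewrite sumrB mulr_suml sumr_const card_ord.
    by rewrite scaler_nat.
  have h (k : 'I_K) : nrm (W ^+ (J * k) * x - x) <= (J * K)%:R * n.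
    apply: le_trans (nrm_powers_sub _ _ hW) _.
    by rewrite ler_wpM2r ?nrm_ge0 // ler_nat leq_mul2l ltnW ?orbT.
  have -> : (J * K * K)%:R * n = \sum_(k < K) (J * K)%:R * n.
    by rewrite sumr_const card_ord natrM mulrAC mulr_natr.
  elim/big_ind2: _ => // [|a b c d h3 h4]; first by rewrite nrm0.
  by apply: le_trans (nrmD _ _) _; rewrite lerD.
have -> : K%:R * sqn x = complex.Re (tr (X * x * star x) -
                          tr ((X * x - K%:R *: x) * star x)).
  rewrite -tauB -mulrBl subKr -scalerAl tauZ sqnE -[K%:R in RHS](rmorph_nat (real_complex R)).
  by rewrite -rmorphM.
rewrite ReB; have := Re_le_normc (tr (X * x * star x)).
have := Re_le_normc (- tr ((X * x - K%:R *: x) * star x)); rewrite normcNE.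
have -> : forall z : R[i], complex.Re (- z) = - complex.Re z by case.
lra.
Qed.

End Mixing.

(** * General position of P and its conjugate *)
Section GeneralPosition.
Context {R : realType} {A : wstarProbSpace R}.
Local Notation tr := (tau A).
Variables (P V : A).
Hypotheses (hP : orthogonal_projection P) (hV : unitary V).
Hypothesis freeVP : star_free2 [set V] [set P].
Implicit Types x y : A.

Let Q := V * P * star V.
Let T := P * Q * P.
Let S := (1 - P) * (1 - Q) * (1 - P).
Local Notation word_endV := (word_end (fun b : bool => if b then [set V] else [set P]) true).

Let hQ : orthogonal_projection Q. Proof. exact: conj_projection. Qed.

Lemma alg_P : star_algebra [set P] P.
Proof. exact: sub_star_algebra. Qed.
Lemma alg_V : star_algebra [set V] V.
Proof. exact: sub_star_algebra. Qed.
Lemma alg_starV : star_algebra [set V] (star V).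
Proof. by have [_ _ _] := star_algebra_unital [set V]; apply; exact: alg_V. Qed.

Lemma word_endV_P y r : word_endV y r -> word_endV (P * y) (P * r).
Proof. by apply: word_end_mull_other => //; exact: alg_P. Qed.
Lemma word_endV_compl y r : word_endV y r -> word_endV ((1 - P) * y) ((1 - P) * r).
Proof.
move=> h; have := word_end_linear (-1) (word_endV_P h) h.
by rewrite !scaleN1r !mulrBl !mul1r ![- _ + _]addrC.
Qed.

Lemma word_endV_pqpX n : exists r, word_endV (T ^+ n) r.
Proof.
elim: n => [|n [r hr]]; first by exists 0; exact: word_end1.
have h1 := word_endV_P hr.
have h2 := word_end_mull freeVP (c := true) alg_starV h1.
have h3 := word_endV_P h2.
have h4 := word_end_mull freeVP (c := true) alg_V h3.
have h5 := word_endV_P h4.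
have -> : T ^+ n.+1 = P * (V * (P * (star V * (P * T ^+ n)))).
  by rewrite exprS {1}/T /Q !mulrA.
by eexists; exact: h5.
Qed.

(** With exact projections e, f in place of T^n, S^n the left-hand side would
    vanish; the right-hand side measures by how much T^n and S^n fail to be fixed
    by Q and by 1 - Q. *)
Lemma kernel_estimate n : (0 < n)%N ->
  normc (tr (S ^+ n) * tr (T ^+ n) - tr (S ^+ n * V) * tr (star V * T ^+ n)) <=
  3 * nrm (S ^+ n * Q) + nrm (T ^+ n * (1 - Q)).
Proof.
case: n => // n _; set m := n.+1.
have [r0 hr0] := word_endV_pqpX m.
have hE := word_endV_P hr0; rewrite KpqpX // in hE.
set E := T ^+ m in hE *.
set r := P * r0 in hE.
have qr : (1 - P) * r = 0 by rewrite /r mulrA mulrBl mul1r hP.1 subrr mul0r.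
have hw := word_endV_compl (word_end_mull freeVP (c := true) alg_starV hE).
set w := (1 - P) * (star V * r + _ - _) in hw.
have r1 : nrm r <= 1.
  apply: le_trans (word_end_nrm freeVP hE) _; exact: nrm_pqpX_le1.
have wq : nrm w <= nrm (E * (1 - Q)).
  apply: le_trans (word_end_nrm freeVP hw) _.
  rewrite -(nrm_unitaryl _ hV) -[leRHS]nrm_star starM /E starX star_pqp // -/E (projection_compl hQ).2.
  suff -> : V * ((1 - P) * (star V * E)) = (1 - Q) * E by [].
  by rewrite !mulrA mulrBr mulr1 mulrBl hV.2.
set F := S ^+ m.
have Fq : F * (1 - P) = F by apply: pqpXK; exact: projection_compl.
have F1 : nrm F <= 1 by apply: nrm_pqpX_le1 => //; exact: projection_compl.
have Fr : F * r = 0 by rewrite -Fq -mulrA qr mulr0.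
have GV : F * V * (1 - P) * star V = F - F * Q.
  by rewrite /Q mulrBr mulr1 mulrBl -(mulrA F V (star V)) hV.2 mulr1 !mulrA.
have wE : F * V * w = - (F * Q * r) + tr E *: (F - F * Q)
                      - tr (star V * E) *: (F * V - F * V * P).
  rewrite /w mulrA mulrBr mulrDr -!scalerAr (mulrA _ (star V) r) GV mulr1.
  by rewrite mulrBl Fr sub0r [F * V * (1 - P)]mulrBr mulr1.
have key : tr F * tr E - tr (F * V) * tr (star V * E) =
  tr (F * V * w) + tr (F * Q * r) + tr E * tr (F * Q)
  - tr (star V * E) * tr (F * V * P).
  by rewrite wE tauB tauD tauN !tauZ !tauB; ring.
have E1 : normc (tr E) <= 1.
  by apply: le_trans (normc_tau_le _) _; apply: nrm_pqpX_le1.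
have VE1 : normc (tr (star V * E)) <= 1.
  apply: le_trans (normc_tau_le _) _; rewrite nrm_unitaryl; last exact: unitary_star.
  exact: nrm_pqpX_le1.
have FVP : nrm (F * V * P) = nrm (F * Q).
  rewrite -(nrm_unitaryr _ (unitary_star hV)) /Q; congr nrm.
  by rewrite !mulrA.
have b1 : normc (tr (F * V * w)) <= nrm (E * (1 - Q)).
  apply: le_trans (cauchy_schwarz _ _) _; rewrite (nrm_unitaryr F hV).
  by apply: (le_trans _ wq); rewrite ler_piMl ?nrm_ge0.
have b2 : normc (tr (F * Q * r)) <= nrm (F * Q).
  apply: le_trans (cauchy_schwarz _ _) _.
  by rewrite ler_piMr ?nrm_ge0.
have b3 : normc (tr E * tr (F * Q)) <= nrm (F * Q).
  rewrite Normc.normcM; apply: le_trans (_ : normc (tr (F * Q)) <= _).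
    by rewrite ler_piMl ?normc_ge0.
  exact: normc_tau_le.
have b4 : normc (tr (star V * E) * tr (F * V * P)) <= nrm (F * Q).
  rewrite Normc.normcM -FVP; apply: le_trans (_ : normc (tr (F * V * P)) <= _).
    by rewrite ler_piMl ?normc_ge0.
  exact: normc_tau_le.
rewrite key; apply: le_trans (normcB _ _) _.
have := normcD (tr (F * V * w) + tr (F * Q * r)) (tr E * tr (F * Q)).
have := normcD (tr (F * V * w)) (tr (F * Q * r)).
lra.
Qed.

Lemma sqn_pqp_compl n : sqn (T ^+ n.+1 * (1 - Q)) = moment T n.+1.*2 - moment T n.+1.*2.+1.
Proof. by rewrite moment_diff_even. Qed.
Lemma sqn_compl_pqp n : sqn (S ^+ n.+1 * Q) = moment S n.+1.*2 - moment S n.+1.*2.+1.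
Proof. by rewrite moment_diff_even ?subKr //; exact: projection_compl. Qed.

(** For a unitary V this says that the moments tend to 0, and so excludes atoms
    in the spectral measure of V. *)
Hypothesis decayV : forall e : R, 0 < e ->
  exists2 J, (0 < J)%N & forall j, (J <= j)%N -> normc (tr (V ^+ j)) <= e.

(** The near equality p r = a b with |a| <= p and |b| <= r forces |b| to be close
    to r when p stays away from 0; the defect 2 (r - |b|) is then exactly the
    squared distance of T^n and w V^-1 T^n, for the phase w of b. *)
Lemma almost_fixed n (c d : R) : 0 < c -> c <= moment S n.*2 ->
  normc (tr (S ^+ n.*2) * tr (T ^+ n.*2) -
         tr (S ^+ n.*2 * V) * tr (star V * T ^+ n.*2)) <= d ->
  exists2 w : R[i], normc w = 1 &
    sqn (w *: star V * T ^+ n - T ^+ n) <= 2 * (d / c).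
Proof.
move=> c0; have hq := projection_compl hP; have hq' := projection_compl hQ.
have hS : sqn (S ^+ n) = moment S n.*2.
  by have := tau_pqp_even hq hq' n; rewrite tau_pqp // => /complexI.
have hT : sqn (T ^+ n) = moment T n.*2.
  by have := tau_pqp_even hP hQ n; rewrite tau_pqp // => /complexI.
set p := moment S n.*2 in hS *; set r := moment T n.*2 in hT * => cp.
rewrite !tau_pqp // -/p -/r.
set a := tr (S ^+ _ * V); set b := tr (star V * _) => hd.
have ha : normc a <= p.
  rewrite /a -addnn exprD -mulrA; apply: le_trans (cauchy_schwarz _ _) _.
  by rewrite nrm_unitaryr // -expr2 nrm_sqr hS.
have hb : normc b <= r.
  rewrite /b -addnn exprD mulrA; apply: le_trans (cauchy_schwarz _ _) _.
  rewrite nrm_unitaryl; last exact: unitary_star.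
  by rewrite -expr2 nrm_sqr hT.
have pr : p * (r - normc b) <= d.
  have := normcD (p%:C * r%:C - a * b) (a * b).
  rewrite subrK !Normc.normcM !normc_real -hS -hT !ger0_norm ?sqn_ge0 //.
  rewrite hS hT => h.
  have := ler_wpM2r (normc_ge0 b) ha.
  by rewrite mulrBr; lra.
have [w w1 wb] := normc_phase b.
exists w => //; set W := w *: star V.
have hW : unitary W by apply: unitaryZ => //; exact: unitary_star.
rewrite sqnB starX star_pqp // -[W * _ * _]mulrA -exprD addnn.
have -> : sqn (W * T ^+ n) = r by rewrite -nrm_sqr nrm_unitaryl // nrm_sqr hT.
rewrite hT /W -scalerAl tauZ -/b wb /=.
have : c * (r - normc b) <= d.
  by apply: le_trans pr; rewrite ler_wpM2r // subr_ge0.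
rewrite -ler_pdivlMl // mulrC => h.
by lra.
Qed.

(** The constants are fixed in the order e = c^2 / 8, then J with moments of
    order at least J bounded by e, then K with 1 / K <= c^2 / 8, and finally an
    exponent for which the error of [kernel_estimate] is below eps. *)
Lemma moments_not_both_bounded_below (c : R) : 0 < c ->
  (forall n, c <= moment T n.+1) -> (forall n, c <= moment S n.+1) ->
  (forall d : R, 0 < d -> exists n, moment T n.+1.*2.*2 - moment T n.+1.*2.*2.+1 <= d /\
                     moment S n.+1.*2.*2 - moment S n.+1.*2.*2.+1 <= d) ->
  False.
Proof.
move=> c0 cT cS small.
have c2 : 0 < c ^+ 2 by rewrite exprn_gt0.
have e0 : 0 < c ^+ 2 / 8 by rewrite divr_gt0.
have [J J0 hJ] := decayV e0.
have [K K0 hK] : exists2 K, (0 < K)%N & 1 <= K%:R * (c ^+ 2 / 8).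
  exists (Num.truncn (c ^+ 2 / 8)^-1).+1 => //.
  rewrite -ler_pdivrMr // div1r ltW //; exact: truncnS_gt.
have JK0 : 0 < (J * K)%:R :> R by rewrite ltr0n muln_gt0 J0.
set g := (J * K)%:R in JK0.
pose eps := c ^+ 3 / (16 * g ^+ 2).
have eps0 : 0 < eps by rewrite divr_gt0 ?mulr_gt0 ?exprn_gt0.
have [n [hT hS]] := small ((eps / 4) ^+ 2) (exprn_gt0 _ (divr_gt0 eps0 (ltr0n _ 4))).
pose m := n.+1.
have nT : nrm (T ^+ m.*2 * (1 - Q)) <= eps / 4.
  rewrite -[leRHS]ger0_norm; last by rewrite divr_ge0 // ltW.
  by rewrite -sqrtr_sqr ler_wsqrtr // /m doubleS sqn_pqp_compl -doubleS.
have nS : nrm (S ^+ m.*2 * Q) <= eps / 4.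
  rewrite -[leRHS]ger0_norm; last by rewrite divr_ge0 // ltW.
  by rewrite -sqrtr_sqr ler_wsqrtr // /m doubleS sqn_compl_pqp -doubleS.
have hest : normc (tr (S ^+ m.*2) * tr (T ^+ m.*2) -
         tr (S ^+ m.*2 * V) * tr (star V * T ^+ m.*2)) <= eps.
  apply: le_trans (kernel_estimate _) _; first by rewrite double_gt0.
  by lra.
have cS' : c <= moment S m.*2 by rewrite -[m.*2]prednK ?double_gt0.
have [w w1] := almost_fixed c0 cS' hest.
set W := w *: star V; set x := T ^+ m => hWx.
have hW : unitary W by apply: unitaryZ => //; exact: unitary_star.
have hJ' j : (J <= j)%N -> normc (tr (W ^+ j)) <= c ^+ 2 / 8.
  move=> /hJ; rewrite /W exprZn tauZ -starX tau_star Normc.normcM normc_conj.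
  have -> : normc (w ^+ j) = 1.
    by elim: j => [|j IH]; rewrite ?Normc.normc1 // exprS Normc.normcM IH w1 mul1r.
  by rewrite mul1r.
have x1 : nrm x <= 1 by apply: nrm_pqpX_le1.
have xx1 : nrm (x * star x) <= 1.
  by rewrite /x starX star_pqp // -exprD addnn; apply: nrm_pqpX_le1.
have := mixing_fixed K hW J0 hJ' x1 xx1.
have -> : sqn x = moment T m.*2.
  by have := tau_pqp_even hP hQ m; rewrite tau_pqp // => /complexI.
have cx := cT m.*2.-1; rewrite prednK ?double_gt0 // in cx.
set eta := nrm _ => main.
have sq : Num.sqrt (K%:R + K%:R ^+ 2 * (c ^+ 2 / 8)) <= K%:R * c / 2.
  rewrite -[leRHS]ger0_norm; last by rewrite divr_ge0 // mulr_ge0 // ltW.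
  rewrite -sqrtr_sqr ler_wsqrtr //.
  have := ler_wpM2l (ler0n R K) hK; rewrite mulr1 => h.
  by move: h; rewrite !expr2; lra.
have k1 : K%:R * c / 2 <= K%:R * (g * eta).
  have := ler_wpM2l (ler0n R K) cx.
  move: main; rewrite natrM -/g mulrAC [_ * K%:R]mulrC; lra.
have k2 : c / 2 <= g * eta.
  by rewrite -(ler_pM2l (_ : 0 < K%:R)) ?ltr0n // mulrA.
have k3 : c ^+ 2 / 4 <= g ^+ 2 * eta ^+ 2.
  rewrite -exprMn (_ : _ / 4 = (c / 2) ^+ 2); last by field.
  by rewrite ler_sqr ?nnegrE ?mulr_ge0 ?divr_ge0 ?nrm_ge0 // ltW.
have : g ^+ 2 * eta ^+ 2 <= g ^+ 2 * (2 * (eps / c)).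
  by rewrite ler_wpM2l ?sqr_ge0 // nrm_sqr.
have -> : g ^+ 2 * (2 * (eps / c)) = c ^+ 2 / 8.
  rewrite /eps; have g0 := lt0r_neq0 JK0; have c1 := lt0r_neq0 c0.
  by clearbody g; field; rewrite c1 g0.
lra.
Qed.

Lemma moment_cvg (theta : R) : tr P = theta%:C ->
  moment T @ \oo --> Num.max (2 * theta - 1) 0.
Proof.
move=> tP; have hq := projection_compl hP; have hq' := projection_compl hQ.
have ts n : moment T n.+1 - moment S n.+1 = 2 * theta - 1.
  rewrite moment_compl // /Q tau_tracial mulrA hV.1 mul1r tP /=; ring.
pose t n := moment T n.+1; pose s n := moment S n.+1.
have td : nonincreasing_seq t.
  by apply/nonincreasing_seqP => n; apply: moment_nincr.
have sd : nonincreasing_seq s.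
  by apply/nonincreasing_seqP => n; apply: moment_nincr.
have tc : cvgn t.
  by apply: nonincreasing_is_cvgn => //; exists 0 => _ [n _ <-]; apply: moment_ge0.
have sc : cvgn s.
  by apply: nonincreasing_is_cvgn => //; exists 0 => _ [n _ <-]; apply: moment_ge0.
have t0 : 0 <= limn t by apply: limr_ge => //; near=> n; apply: moment_ge0.
have s0 : 0 <= limn s by apply: limr_ge => //; near=> n; apply: moment_ge0.
have lts : limn t - limn s = 2 * theta - 1.
  rewrite -limB //; apply: lim_near_cst => //; near=> n; exact: ts.
have tl n : limn t <= t n by apply: nonincreasing_cvgn_ge.
have sl n : limn s <= s n by apply: nonincreasing_cvgn_ge.
have L0 : Num.min (limn t) (limn s) <= 0.
  rewrite leNgt; apply/negP => c0.
  apply: (moments_not_both_bounded_below c0) => [n|n|d d0].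
  - by apply: le_trans (tl n); rewrite ge_min lexx.
  - by apply: le_trans (sl n); rewrite ge_min lexx orbT.
  have ht : \forall n \near \oo, t n <= limn t + d.
    by apply: (cvgr_le _ tc); rewrite ltrDl.
  have hs : \forall n \near \oo, s n <= limn s + d.
    by apply: (cvgr_le _ sc); rewrite ltrDl.
  have [N _ hN] := filterI ht hs.
  have [|h1 h2] := hN (N.+1.*2.*2.-1).
    change (N <= N.+1.*2.*2.-1)%N; rewrite -ltnS prednK ?double_gt0 //.
    by rewrite -!muln2 -mulnA leq_pmulr.
  exists N; split.
    have := tl N.+1.*2.*2; move: h1; rewrite /t prednK ?double_gt0 //; lra.
  have := sl N.+1.*2.*2; move: h2; rewrite /s prednK ?double_gt0 //; lra.
have -> : Num.max (2 * theta - 1) 0 = limn t.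
  move: L0; rewrite minElt maxElt; case: ifP => h1 h2; case: ifP; move: h1 h2; lra.
by rewrite -cvg_shiftS.
Unshelve. all: by end_near.
Qed.

End GeneralPosition.

(** * The mass at 1 as a limit of moments *)
Section AtomOfMoments.
Context {R : realType}.
Variables (nu : probability (measurableTypeR R) R) (a : nat -> R) (M : R).
Hypothesis inta : forall n : nat, (0 < n)%N ->
  nu.-integrable [set: R] (fun x : R => (x ^+ n)%:E) /\
  a n = (\int[nu]_(x in [set: R]) (x ^+ n))%R.
Hypothesis a_le : forall n : nat, (0 < n)%N -> a n <= M.

Lemma integral_moment n : (0 < n)%N ->
  (\int[nu]_(x in [set: R]) (x ^+ n)%:E)%E = (a n)%:E.
Proof.
move=> n0; have [h1 h2] := inta n0.
by rewrite h2 /Rintegral fineK //; exact: integrable_fin_num.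
Qed.

(** Markov's inequality for x^(2n), with n tending to infinity. *)
Lemma negligible_ge (r : R) : 1 < r -> nu.-negligible [set x : R | r <= `|x|].
Proof.
move=> r1; have r0 : 0 < r by apply: lt_trans r1.
pose B := [set: R] `&` [set x : R | (r%:E <= `|x%:E|)%E].
have mB : measurable B.
  rewrite /B setTI (_ : [set x | _] = (Num.norm : R -> R) @^-1` `[r, +oo[); last first.
    by apply/seteqP; split => x /=; rewrite in_itv /= lee_fin andbT.
  by rewrite -[X in measurable X]setTI; apply: (@normr_measurable R setT).
have -> : [set x : R | r <= `|x|] = B.
  by rewrite /B setTI; apply/seteqP; split => x /=; rewrite lee_fin.
exists B; split=> //.
have fB : nu B = (fine (nu B))%:E by rewrite fineK // fin_num_measure.
rewrite fB; congr EFin; set b := fine _ in fB *.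
have b0 : 0 <= b by rewrite /b fine_ge0.
apply/eqP; rewrite eq_le b0 andbT.
have hb n : (0 < n)%N -> b <= M * r^-1 ^+ n.*2.
  move=> n0; rewrite exprVn ler_pdivlMr ?exprn_gt0 // mulrC.
  rewrite -lee_fin EFinM -fB.
  have := @le_integral_abse _ _ _ nu setT measurableT
     (fun x : R => (x ^+ n.*2)%:E) (r ^+ n.*2).
  have d0 : (0 < n.*2)%N by rewrite double_gt0.
  have [ia _] := inta d0.
  move=> /(_ (measurable_int _ ia) (exprn_gt0 _ r0)).
  have e : [set x : R | ((r ^+ n.*2)%:E <= `|(x ^+ n.*2)%:E|)%E] = 
           [set x : R | (r%:E <= `|x%:E|)%E].
    apply/seteqP; split => x /=; rewrite !lee_fin normrX ler_pXn2r ?nnegrE //;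
      by rewrite ?double_gt0 ?ltW.
  rewrite e -/B => h; apply: le_trans h _.
  have -> : (\int[nu]_(x in [set: R]) `|(x ^+ n.*2)%:E| =
             \int[nu]_(x in [set: R]) (x ^+ n.*2)%:E)%E.
    apply: eq_integral => x _; rewrite /= ger0_norm //.
    by rewrite -mul2n exprM exprn_ge0 // sqr_ge0.
  by rewrite integral_moment ?lee_fin ?a_le // double_gt0.
have cv : M * r^-1 ^+ n.*2 @[n --> \oo] --> (0 : R).
  rewrite -[X in _ --> X](mulr0 M); apply: cvgMr.
  under eq_fun do rewrite -mul2n exprM.
  apply: cvg_expr; rewrite ger0_norm ?exprn_ge0 ?invr_ge0 ?(ltW r0) //.
  by rewrite expr_lt1 ?invr_ge0 ?(ltW r0) // invf_lt1.
apply: (ler_cvg_to (cvg_cst b) cv).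
by near=> n; apply: hb; near: n; exists 1%N.
Unshelve. all: by end_near.
Qed.

Lemma ae_norm_le1 : {ae nu, forall x : R, `|x| <= 1}.
Proof.
have h k : nu.-negligible [set x : R | 1 + k.+1%:R^-1 <= `|x|].
  by apply: negligible_ge; rewrite ltrDl.
apply: negligibleS (negligible_bigcup h) => x /= /negP; rewrite -ltNge => x1.
by have [k hk] := ltr_add_invr x1; exists k => //; exact: ltW.
Qed.

(** Dominated convergence for x^(2n) + x^(2n+1), which tends to twice the
    indicator of 1 on [-1, 1]: using two consecutive exponents cancels the
    contribution of -1. *)
Lemma atom_of_moments (l : R) : a @ \oo --> l -> nu [set 1] = l%:E.
Proof.
move=> al.
pose f n (x : measurableTypeR R) := ((x : R) ^+ n.+1.*2 + (x : R) ^+ n.+1.*2.+1)%:E.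
pose g (x : measurableTypeR R) := (2 * \1_[set (1 : R)] (x : R) : R)%:E.
have mf n : measurable_fun setT (f n).
  by apply/measurable_EFinP; apply: measurable_funD; exact: exprn_measurable.
have mg : measurable_fun setT g.
  by apply/measurable_EFinP; apply: measurable_funM => //; exact: measurable_indic.
have cvfg x : `|x| <= 1 -> f ^~ x @ \oo --> g x.
  move=> x1; apply: cvg_EFin; first by near=> n.
  rewrite /g /= indicE /=.
  have [->|xN1] := eqVneq x 1.
    rewrite mem_set // mulr1; apply: cvg_near_cst; near=> n.
    by rewrite /f /= !expr1n.
  rewrite memNset ?mulr0; last exact/eqP.
  have [->|xN0] := eqVneq x (-1).
    apply: cvg_near_cst; near=> n.
    by rewrite /f /= exprS -mul2n exprM sqrrN expr1n expr1n mulr1 subrr.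
  have xl : `|x| < 1.
    rewrite lt_def x1 andbT eq_sym; apply/negP; rewrite eqr_norml ler01 andbT.
    by rewrite (negbTE xN1) (negbTE xN0).
  have c0 : (2 * `|x| ^+ n) @[n --> \oo] --> (0 : R).
    by rewrite -[X in _ --> X](mulr0 2); apply: cvgMr; apply: cvg_expr; rewrite normr_id.
  apply/norm_cvg0P; apply: (squeeze_cvgr _ (cvg_cst 0) c0).
  near=> n; rewrite normr_ge0 /=.
  rewrite /f /=; apply: le_trans (ler_normD _ _) _.
  rewrite !normrX mulr_natl mulr2n lerD // ler_wiXn2l //.
    by rewrite -addnn addSn leqW // leq_addr.
  by rewrite -addnn addSn !leqW // leq_addr.
have ff : {ae nu, forall x, [set: R] x -> f ^~ x @ \oo --> g x}.
  by apply: negligibleS ae_norm_le1 => x /= h1 h2; apply: h1 => _; apply: cvfg.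
have ig : nu.-integrable [set: R] (cst 2%:E).
  exact: finite_measure_integrable_cst.
have fg : {ae nu, forall x n, [set: R] x -> (`|f n x| <= cst 2%:E x)%E}.
  apply: negligibleS ae_norm_le1 => x /= h1 h2; apply: h1 => n _.
  rewrite /f /= lee_fin.
  apply: le_trans (ler_normD _ _) _; rewrite !normrX.
  by rewrite (_ : 2 = 1 + 1) // lerD // exprn_ile1.
have [_ _ dc] := dominated_convergence measurableT mf mg ff ig fg.
have intf n : (\int[nu]_(x in [set: R]) f n x)%E =
    (a n.+1.*2 + a n.+1.*2.+1)%:E.
  have [i1 _] := inta (isT : (0 < n.+1.*2)%N).
  have [i2 _] := inta (isT : (0 < n.+1.*2.+1)%N).
  by rewrite EFinD -!integral_moment // -integralD.
have intg : (\int[nu]_(x in [set: R]) g x)%E = (2%:E * nu [set 1%R])%E.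
  rewrite /g; under eq_integral do rewrite EFinM.
  rewrite integralZl //; last exact: integrable_indic.
  by rewrite integral_indic // setIT.
rewrite intg in dc.
have c2 : (fun n => (a n.+1.*2 + a n.+1.*2.+1)%:E) @ \oo --> (l + l)%:E.
  apply: cvg_EFin; first by near=> n.
  apply: cvgD.
    apply: (cvg_comp (fun n => n.+1.*2) a) al => B [N _ hN].
    exists N => // n /= Nn; apply: hN => /=.
    by rewrite (leq_trans Nn) // -addnn addSn leqW // leq_addr.
  apply: (cvg_comp (fun n => n.+1.*2.+1) a) al => B [N _ hN].
  exists N => // n /= Nn; apply: hN => /=.
  by rewrite (leq_trans Nn) // -addnn addSn !leqW // leq_addr.
have e : (2%:E * nu [set 1%R] = (l + l)%:E)%E.
  by apply: cvg_unique dc _ => //; rewrite /mkseq (funext intf).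
have fin1 : nu [set 1] \is a fin_num by apply: fin_num_measure.
move: e; rewrite -(fineK fin1) -EFinM => -[] h; congr EFin; lra.
Unshelve. all: by end_near.
Qed.
End AtomOfMoments.

(** * Decay of the moments of the free unitary Brownian motion *)
Section Laguerre.
Context {R : realType}.
Implicit Types (p : {poly R}) (c x a b : R).

Definition pexp p c x : R := p.[x] * expR (- (c * x)).

Lemma is_derive_pexp p c x :
  is_derive x 1 (pexp p c) (pexp (p^`() - c *: p) c x).
Proof.
have d1 : is_derive x 1 (horner p) p^`().[x] by exact: is_derive_poly.
have d2 : is_derive x 1 (fun y : R => - (c * y)) (- c).
  by apply: is_derive_eq; rewrite scaler1 //.
have d3 : is_derive x 1 (fun y : R => expR (- (c * y))) (- c * expR (- (c * x))).
  by apply: (is_derive_eq (is_derive1_comp _ _)) => //; rewrite mulrC.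
apply: (is_derive_eq (is_deriveM d1 d3)).
rewrite /pexp hornerD hornerN hornerZ.
have sc (u v : R) : u *: (v : R^o) = u * v by []. rewrite !sc.
by ring.
Qed.

Lemma pexp_mvt p c a b : a <= b -> exists2 x, a <= x <= b &
  pexp p c b - pexp p c a = pexp (p^`() - c *: p) c x * (b - a).
Proof.
move=> ab; have [x _||x xab h] := @MVT_segment R (pexp p c) (pexp (p^`() - c *: p) c) a b ab.
- exact: is_derive_pexp.
- apply: derivable_within_continuous => x _.
  by have [] := is_derive_pexp p c x.
by exists x => //; move: xab; rewrite in_itv.
Qed.

Lemma pexp_nincr p c a b : a <= b ->
  (forall x, a <= x <= b -> (p^`() - c *: p).[x] <= 0) -> pexp p c b <= pexp p c a.
Proof.
move=> ab hp; have [x xab h] := pexp_mvt p c ab.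
rewrite -subr_le0 h; apply: mulr_le0_ge0; last by rewrite subr_ge0.
by apply: mulr_le0_ge0; [exact: hp|exact: expR_ge0].
Qed.

(** The witness makes x^(n+1) / (n+1)! <= exp x dominate the bound C x^n of the
    polynomial, where n is its size. *)
Lemma pexp_small p a d : 0 < d -> exists2 x, a <= x & pexp p 1 x < d.
Proof.
move=> d0; pose n := size p; pose C := \sum_(i < n) `|p`_i|.
have C0 : 0 <= C by apply: sumr_ge0.
pose x := Num.max (Num.max 1 a) ((C + 1) * n.+1`!%:R / d).
have x1 : 1 <= x by rewrite /x !le_max lexx.
have x0 : 0 <= x by apply: le_trans x1.
exists x; first by rewrite /x !le_max lexx orbT.
rewrite /pexp mul1r expRN ltr_pdivrMr ?expR_gt0 //.
have h1 : p.[x] <= C * x ^+ n.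
  rewrite horner_coef /C mulr_suml; apply: ler_sum => i _.
  apply: le_trans (ler_norm _) _; rewrite normrM ler_wpM2l // ger0_norm ?exprn_ge0 //.
  by apply: ler_weXn2l => //; exact: ltnW.
have h2 : x ^+ n.+1 / n.+1`!%:R < expR x.
  by have := expR_ge1Dxn n x0; lra.
have f0 : 0 < n.+1`!%:R :> R by rewrite ltr0n fact_gt0.
apply: le_lt_trans h1 _; apply: le_lt_trans (_ : d * (x ^+ n.+1 / n.+1`!%:R) < _); last first.
  by rewrite ltr_pM2l.
have h3 : (C + 1) * n.+1`!%:R / d <= x by rewrite /x le_max lexx orbT.
rewrite ler_pdivrMr // in h3.
rewrite mulrA ler_pdivlMr // exprS mulrCA mulrA [x * d]mulrC.
rewrite -mulrA [_ * n.+1`!%:R]mulrC mulrA.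
rewrite ler_wpM2r ?exprn_ge0 //.
rewrite [d * x]mulrC; apply: le_trans h3.
by apply: ler_wpM2r; [exact: ltW|rewrite lerDl].
Qed.

Section FixedDegree.
Variable n : nat.
Let k : R := n.+1%:R.
Let L : {poly R} := laguerre R 1 n.

Lemma laguerre_coef j : L`_j = (-1) ^+ j * 'C(n.+1, j.+1)%:R / j`!%:R.
Proof.
rewrite coef_poly; case: ltnP => jn.
  by rewrite addn1 -(bin_sub (_ : j.+1 <= n.+1)%N) ?subSS.
by rewrite bin_small ?ltnS // mulr0 mul0r.
Qed.

Lemma laguerre_coef_rec j :
  (j.+1 * j.+2)%:R * L`_j.+1 + (k - 1 - j%:R) * L`_j = 0.
Proof.
rewrite !laguerre_coef.
have h : j.+2%:R * 'C(n.+1, j.+2)%:R = (k - 1 - j%:R) * 'C(n.+1, j.+1)%:R :> R.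
  have := mul_bin_left n.+1 j.+1; rewrite subSS => e.
  rewrite -natrM e /k -natr1 addrK; case: (leqP j n) => jn.
    by rewrite natrM natrB.
  by rewrite bin_small ?ltnS // muln0 mulr0.
have f0 : j`!%:R != 0 :> R by rewrite pnatr_eq0 -lt0n fact_gt0.
have j0 : j.+1%:R != 0 :> R by rewrite pnatr_eq0.
rewrite factS !natrM exprS invfM.
move: (j.+1%:R : R) (j.+2%:R : R) (j`!%:R : R) j0 f0 h => u v w u0 w0 h.
transitivity ((-1) ^+ j / w * ((k - 1 - j%:R) * 'C(n.+1, j.+1)%:R -
    v * 'C(n.+1, j.+2)%:R)); last by rewrite h subrr mulr0.
by field; rewrite u0 w0.
Qed.

(** Laguerre's equation for parameter 1 and degree n = k - 1; on coefficients it
    is the preceding recurrence. *)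
Lemma laguerre_ode x :
  x * L^`()^`().[x] + (2 - x) * L^`().[x] + (k - 1) * L.[x] = 0.
Proof.
have : 'X * L^`()^`() + 2%:R *: L^`() - 'X * L^`() + (k - 1) *: L = 0.
  apply/polyP => j; rewrite !(coefD, coefN, coefZ, coefXM, coef_deriv, coef0).
  have := laguerre_coef_rec j.
  by case: j => [|j] /= e; rewrite -[RHS]e ?natrM; ring.
move=> /(congr1 (fun q => q.[x])).
by rewrite !(hornerD, hornerN, hornerZ, hornerM, hornerX) horner0 => <-; ring.
Qed.

(** With u = exp(-x/2) g: dg, Phi and Psi are the polynomial factors of
    u' = exp(-x/2) dg, of the energy u'^2 + (k/x - 1/4) u^2 = exp(-x) Phi and of
    u u' = exp(-x) Psi. *)
Let g : {poly R} := 'X * L.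
Let dg : {poly R} := g^`() - 2^-1 *: g.
Let Phi : {poly R} := dg ^+ 2 + k *: ('X * L ^+ 2) - 4^-1 *: g ^+ 2.
Let Psi : {poly R} := g * dg.

Lemma horner_g x : g.[x] = x * L.[x].
Proof. by rewrite hornerM hornerX. Qed.
Lemma horner_dg x : dg.[x] = L.[x] + x * L^`().[x] - 2^-1 * (x * L.[x]).
Proof. by rewrite /dg hornerD hornerN hornerZ /g derivM derivX mul1r !hornerE. Qed.
Lemma horner_ddg x :
  dg^`().[x] = 2 * L^`().[x] + x * L^`()^`().[x] - 2^-1 * (L.[x] + x * L^`().[x]).
Proof.
have gE : g^`() = L + 'X * L^`() by rewrite /g derivM derivX mul1r.
rewrite /dg derivB derivZ gE derivD derivM derivX mul1r.
by rewrite !(hornerD, hornerN, hornerZ, hornerM, hornerX); ring.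
Qed.
Lemma horner_g' x : g^`().[x] = L.[x] + x * L^`().[x].
Proof. by rewrite /g derivM derivX mul1r !hornerE. Qed.

Lemma horner_Phi x :
  Phi.[x] = dg.[x] ^+ 2 + k * (x * L.[x] ^+ 2) - 4^-1 * (x * L.[x]) ^+ 2.
Proof.
have h := horner_g x; rewrite /Phi; clear Phi Psi; clearbody dg; clearbody g.
by rewrite !(hornerD, hornerN, hornerZ, hornerM, hornerX, horner_exp) h.
Qed.

Lemma energy_deriv x : (Phi^`() - 1 *: Phi).[x] = - k * L.[x] ^+ 2.
Proof.
have [[[h1 h2] h3] h4] :=
  (horner_dg x, horner_ddg x, horner_g' x, horner_g x).
rewrite scale1r /Phi; clear Phi Psi; clearbody dg; clearbody g.
rewrite !expr2 !(derivD, derivN, derivZ, derivM) derivX mul1r.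
rewrite !(hornerD, hornerN, hornerZ, hornerM, hornerX) h1 h2 h3 h4.
have := laguerre_ode x; set y := _ + _ => y0.
transitivity (- k * L.[x] ^+ 2 + 2 * (L.[x] + x * L^`().[x] - 2^-1 * (x * L.[x])) * y).
  by rewrite /y; field.
by rewrite y0 mulr0 addr0.
Qed.

(** Up to the factor exp(-x) this is (u u')' = u'^2 + u u''; it is nonnegative
    once x >= 4k. *)
Lemma growth_deriv x : (Psi^`() - 1 *: Psi).[x] =
  dg.[x] ^+ 2 + (x / 4 - k) * (x * L.[x] ^+ 2).
Proof.
have [[[h1 h2] h3] h4] :=
  (horner_dg x, horner_ddg x, horner_g' x, horner_g x).
rewrite scale1r /Psi; clear Phi Psi; clearbody dg; clearbody g.
rewrite derivM !(hornerD, hornerN, hornerM) h1 h2 h3 h4.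
have := laguerre_ode x; set y := _ + _ => y0.
transitivity ((L.[x] + x * L^`().[x] - 2^-1 * (x * L.[x])) ^+ 2 +
  (x / 4 - k) * (x * L.[x] ^+ 2) + x * L.[x] * y).
  by rewrite /y; field.
by rewrite y0 mulr0 addr0.
Qed.

Lemma g_sqr_deriv x : ((g ^+ 2)^`() - 1 *: g ^+ 2).[x] = 2 * Psi.[x].
Proof.
rewrite /Psi /dg; clearbody Psi Phi; clearbody dg; clearbody g.
rewrite scale1r expr2 derivM !(hornerD, hornerN, hornerZ, hornerM).
by field.
Qed.

Lemma k_gt0 : 0 < k. Proof. by rewrite ltr0n. Qed.

Lemma energy_le x : 0 <= x -> pexp Phi 1 x <= k ^+ 2.
Proof.
move=> x0; have -> : k ^+ 2 = pexp Phi 1 0.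
  rewrite /pexp mulr0 oppr0 expR0 mulr1 horner_Phi horner_dg !mul0r !mulr0.
  rewrite horner_coef0 laguerre_coef expr0 mul1r bin1 fact0 divr1 -/k.
  by ring.
apply: pexp_nincr => // y _; rewrite energy_deriv.
by rewrite mulNr oppr_le0 mulr_ge0 ?sqr_ge0 // ltW // k_gt0.
Qed.

Let u := pexp g 2^-1.

Lemma pexp_sqr p x : pexp p 2^-1 x ^+ 2 = pexp (p ^+ 2) 1 x.
Proof.
rewrite /pexp exprMn -expRM_natl horner_exp; congr (_ * expR _).
by rewrite mul1r; field.
Qed.

Lemma uE x : u x = x * (L.[x] * expR (- (2^-1 * x))).
Proof. by rewrite /u /pexp horner_g mulrA. Qed.

Lemma energy_split x :
  pexp dg 2^-1 x ^+ 2 + (k / x - 4^-1) * u x ^+ 2 = pexp Phi 1 x.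
Proof.
rewrite pexp_sqr uE; have [->|x0] := eqVneq x 0.
  rewrite mul0r expr0n mulr0 addr0 /pexp horner_exp horner_Phi; congr (_ * _).
  by ring.
rewrite !exprMn -expRM_natl (_ : 2%:R * - (2^-1 * x) = - (1 * x)); last by field.
rewrite /pexp horner_exp horner_Phi.
by field.
Qed.

Lemma u_le_oscillating s x : 0 < s < 4 -> 0 < x <= k * s ->
  u x ^+ 2 <= k ^+ 2 * (4 * s / (4 - s)).
Proof.
move=> /andP[s0 s4] /andP[x0 xs].
have := energy_le (ltW x0); rewrite -energy_split => e.
have c : (4 - s) / (4 * s) <= k / x - 4^-1.
  have -> : (4 - s) / (4 * s) = s^-1 - 4^-1.
    by have s1 := lt0r_neq0 s0; field.
  rewrite lerD2r ler_pdivlMr // mulrC ler_pdivrMr //.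
have d0 : 0 < (4 - s) / (4 * s) by rewrite divr_gt0 ?subr_gt0 ?mulr_gt0.
have -> : 4 * s / (4 - s) = ((4 - s) / (4 * s))^-1 by rewrite invf_div.
rewrite ler_pdivlMr // mulrC; apply: le_trans (ler_wpM2r (sqr_ge0 _) c) _.
by have := sqr_ge0 (pexp dg 2^-1 x); lra.
Qed.

(** Before the turning point both terms of the energy are nonnegative, so u'^2 is
    at most k^2. *)
Lemma u_lipschitz a b : 0 <= a -> a <= b -> b <= 4 * k ->
  `|u b - u a| <= k * (b - a).
Proof.
move=> a0 ab bk; have [x /andP[ax xb] ->] := pexp_mvt g 2^-1 ab.
rewrite -/dg normrM [`|b - a|]ger0_norm ?subr_ge0 //.
rewrite ler_wpM2r ?subr_ge0 //.
rewrite -(@ler_sqr R) ?nnegrE ?normr_ge0 ?(ltW k_gt0) // real_normK ?num_real //.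
have x0 := le_trans a0 ax.
have := energy_le x0; rewrite -energy_split => e.
have : 0 <= (k / x - 4^-1) * u x ^+ 2.
  have [x00|x00] := eqVneq x 0.
    by rewrite uE x00 mul0r expr0n mulr0.
  rewrite mulr_ge0 ?sqr_ge0 // subr_ge0 ler_pdivlMr ?lt_def ?x00 ?x0 //.
  by rewrite mulrC ler_pdivrMr // mulrC (le_trans xb).
by lra.
Qed.

(** Beyond the turning point u u' increases; being a polynomial times exp(-x), it
    cannot stay above a positive value. *)
Lemma growth_le0 x : 4 * k <= x -> pexp Psi 1 x <= 0.
Proof.
move=> kx; rewrite leNgt; apply/negP => G0.
have [y xy] := pexp_small Psi x G0; rewrite ltNge => /negP; apply.
have [z /andP[xz zy] h] := pexp_mvt Psi 1 xy.
rewrite -subr_ge0 h; apply: mulr_ge0; last by rewrite subr_ge0.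
apply: mulr_ge0; last exact: expR_ge0.
have kz : 4 * k <= z by apply: le_trans xz.
have z0 : 0 <= z by apply: le_trans kz; rewrite mulr_ge0 // ltW // k_gt0.
rewrite growth_deriv; apply: addr_ge0; first exact: sqr_ge0.
apply: mulr_ge0; last by rewrite mulr_ge0 ?sqr_ge0.
by rewrite subr_ge0 ler_pdivlMr // mulrC.
Qed.

Lemma u_decay x : 4 * k <= x -> `|u x| <= `|u (4 * k)|.
Proof.
move=> kx; rewrite -(@ler_sqr R) ?nnegrE ?normr_ge0 // !real_normK ?num_real //.
rewrite /u !pexp_sqr; have [z /andP[kz zx] h] := pexp_mvt (g ^+ 2) 1 kx.
rewrite -subr_le0 h; apply: mulr_le0_ge0; last by rewrite subr_ge0.
have -> : pexp ((g ^+ 2)^`() - 1 *: g ^+ 2) 1 z = 2 * pexp Psi 1 z.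
  by rewrite /pexp g_sqr_deriv mulrA.
by have := growth_le0 kz; lra.
Qed.

(** Up to ks the energy bounds u; from there to the turning point 4k it bounds
    the variation of u, and afterwards |u| decreases.  The second term becomes
    small against k^2 as s tends to 4. *)
Lemma u_bound s t : 0 < s < 4 -> 0 < t ->
  `|u (k * t)| <= k * Num.sqrt (4 * s / (4 - s)) + k ^+ 2 * (4 - s).
Proof.
move=> s04 t0; have /andP[s0 s4] := s04; have k0 := k_gt0.
have q0 : 0 <= 4 * s / (4 - s) by rewrite divr_ge0 ?mulr_ge0 ?subr_ge0 // ltW.
have osc x : 0 < x <= k * s -> `|u x| <= k * Num.sqrt (4 * s / (4 - s)).
  move=> hx; rewrite -(@ler_sqr R) ?nnegrE ?normr_ge0 ?mulr_ge0 ?sqrtr_ge0 ?(ltW k0) //.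
  by rewrite real_normK ?num_real // [(k * _) ^+ 2]exprMn sqr_sqrtr //; exact: u_le_oscillating.
have mid x : k * s <= x -> x <= 4 * k ->
    `|u x| <= k * Num.sqrt (4 * s / (4 - s)) + k ^+ 2 * (4 - s).
  move=> sx xk; rewrite -[u x](subrK (u (k * s))) addrC.
  apply: le_trans (ler_normD _ _) _; apply: lerD.
    by apply: osc; rewrite mulr_gt0 //= lexx.
  apply: le_trans (u_lipschitz _ sx xk) _; first by rewrite mulr_ge0 // ltW.
  by rewrite expr2 -mulrA ler_wpM2l ?(ltW k0) // mulrBr lerD2r mulrC.
have [ts|/ltW st] := leP t s.
  apply: le_trans (osc _ _) _; first by rewrite mulr_gt0 //= ler_wpM2l // ltW.
  by rewrite lerDl mulr_ge0 ?sqr_ge0 // subr_ge0 ltW.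
have [t4|/ltW t4] := leP t 4.
  by apply: mid; rewrite ?[4 * k]mulrC ler_wpM2l // ltW.
apply: le_trans (u_decay _) _; first by rewrite mulrC ler_wpM2l // ltW.
by apply: mid; rewrite // mulrC ler_wpM2r // ltW.
Qed.

End FixedDegree.

Lemma laguerre_moment_small (t e : R) : 0 < t -> 0 < e ->
  exists2 J, (0 < J)%N & forall j, (J <= j)%N ->
  `|expR (- (j%:R * t) / 2) * j%:R^-1 * (laguerre R 1 j.-1).[j%:R * t]| <= e.
Proof.
move=> t0 e0; pose d := Num.min 2 (e * t / 2).
have d0 : 0 < d by rewrite lt_min ltr0n divr_gt0 ?mulr_gt0.
have d2 : d <= 2 by rewrite ge_min lexx.
have de : d <= e * t / 2 by rewrite ge_min lexx orbT.
pose s := 4 - d; have s04 : 0 < s < 4 by rewrite /s; apply/andP; split; lra.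
pose D := Num.sqrt (4 * s / (4 - s)); have D0 : 0 <= D := sqrtr_ge0 _.
(* Both terms of u_bound are at most half of e k^2 t: the first for k large,
   the second by the choice of d = 4 - s. *)
exists (Num.truncn (2 * D / (e * t))).+1 => // j.
case: j => // n nJ; rewrite [_.-1]/=.
set k := n.+1%:R : R; have k0 : 0 < k by rewrite ltr0n.
have Dk : D <= k * (e * t / 2).
  have : 2 * D / (e * t) <= k.
    by apply: ltW; apply: lt_le_trans (truncnS_gt _) _; rewrite ler_nat.
  rewrite ler_pdivrMr ?mulr_gt0 //; lra.
have := u_bound n s04 t0; rewrite -/k -/D uE -/k.
have -> : 4 - s = d by rewrite /s; ring.
set m := _ * expR _ => h.
have -> : expR (- (k * t) / 2) * k^-1 * (laguerre R 1 n).[k * t] = m / k.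
  rewrite (_ : - (k * t) / 2 = - (2^-1 * (k * t))); last by field.
  by rewrite /m mulrAC [expR _ * _]mulrC.
rewrite normrM normfV [`|k|]gtr0_norm // ler_pdivrMr //.
move: h; rewrite normrM gtr0_norm ?mulr_gt0 // => h.
rewrite -(ler_pM2l (mulr_gt0 k0 t0)); apply: le_trans h _.
have h1 := ler_wpM2l (ltW k0) Dk.
have h2 := ler_wpM2l (sqr_ge0 k) de.
apply: le_trans (lerD h1 h2) _.
by rewrite le_eqVlt; apply/orP; left; apply/eqP; field.
Qed.

End Laguerre.

(** * The mass at 1 of the compressed conjugate *)
Lemma star_free2_mono (R : realType) (A : wstarProbSpace R) (G1 G1' G2 G2' : set A) :
  G1' `<=` G1 -> G2' `<=` G2 -> star_free2 G1 G2 -> star_free2 G1' G2'.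
Proof.
move=> s1 s2 h w w0 srt hw; apply: h => // p pw; have [h1 h2] := hw p pw.
by split=> //; case: (p.1) h1; apply: star_algebra_mono.
Qed.

Lemma mass_at_one (R : realType) (A : wstarProbSpace R) (P V : A) (theta : R)
  (nu : probability (measurableTypeR R) R) :
  orthogonal_projection P -> tau A P = theta%:C -> 0 < theta ->
  unitary V -> star_free2 [set V] [set P] ->
  (forall e : R, 0 < e ->
     exists2 J, (0 < J)%N & forall j, (J <= j)%N -> normc (tau A (V ^+ j)) <= e) ->
  spectral_distribution P (P * V * P * star V * P) nu ->
  nu [set 1] = (theta^-1 * Num.max (2 * theta - 1) 0)%:E.
Proof.
move=> hP tP th0 hV hfree hmix [_ _ hnu].
have hQ := conj_projection hV hP.
pose T := P * (V * P * star V) * P.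
have TE : P * V * P * star V * P = T by rewrite /T !mulrA.
have limT := moment_cvg hP hV hfree hmix tP.
have intT n : (0 < n)%N ->
    theta^-1 * moment T n = (\int[nu]_(x in [set: R]) (x ^+ n))%R.
  move=> n0; have [_ h] := hnu n n0; apply: complexI; rewrite -h TE tau_pqp //.
  by rewrite tP -fmorphV -rmorphM.
apply: (atom_of_moments (a := fun n => theta^-1 * moment T n) (M := theta^-1)).
- by move=> n n0; rewrite intT //; split=> //; have [] := hnu n n0.
- by move=> n n0; rewrite ler_piMr ?invr_ge0 ?(ltW th0) // moment_le1.
- exact: cvgMr.
Qed.

Theorem corollary1 (R : realType) (A : wstarProbSpace R) (P : A) (theta : R)
  (Y : R -> A) (U : A)
  (hP : orthogonal_projection P)
  (htau : tau A P = theta%:C)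
  (htheta : 0 < theta < 1)
  (hY : free_unitary_brownian_motion Y)
  (hYP : star_free2 (Y @` [set t | 0 <= t]) [set P])
  (hU : haar_unitary U)
  (hUP : star_free2 [set U] [set P])
  (t : R) (ht : 0 < t)
  (nuY nuU : probability (measurableTypeR R) R)
  (hnuY : spectral_distribution P (P * Y t * P * star (Y t) * P) nuY)
  (hnuU : spectral_distribution P (P * U * P * star U * P) nuU) :
  nuY [set 1] = nuU [set 1] /\
  nuU [set 1] = (theta^-1 * Num.max (2 * theta - 1) 0)%:E.
Proof.
have /andP[th0 _] := htheta.
have wU : nuU [set 1] = (theta^-1 * Num.max (2 * theta - 1) 0)%:E.
  have [uU mU] := hU.
  apply: (mass_at_one hP htau th0 uU hUP _ hnuU) => e e0.
  exists 1%N => // j j1; have [-> _] := mU j j1.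
  by rewrite Normc.normc0 ltW.
split=> //; rewrite wU.
have [uY _ _ _ mY] := hY.
apply: (mass_at_one hP htau th0 (uY t (ltW ht)) _ _ hnuY).
  apply: (star_free2_mono _ _ hYP) => // _ ->.
  by exists t => //=; exact: ltW.
move=> e e0; have [J J0 hJ] := laguerre_moment_small ht e0.
exists J => // j Jj; have j0 : (0 < j)%N by apply: leq_trans Jj.
have [-> _] := mY t j (ltW ht) j0.
by rewrite normc_real; exact: hJ.
Qed.
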